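(* Let $Z$ be a set and $A=\mathbf{k}\mathcal{M}(Z)/I_A$ a unital algebra, where the ideal $I_A$ has a GS basis $G$ with respect to $\le_{\mathrm{dlex}}$. Let $c\in\mathbf{k}$ and let $\phi$ be the OPI $\phi(z)=\lfloor z\rfloor-cz$. Then $S_\phi(Z)\cup G$ is an operated GS basis of $\langle S_\phi(Z)\cup I_A\rangle_{\mathrm{uOpAlg}}$ in $\mathbf{k}\mathfrak{M}(Z)$ with respect to the monomial order $\le$ on $\mathfrak{M}(Z)$, and $$\mathrm{Irr}(S_\phi(Z)\cup G)=\mathfrak{M}(Z)\setminus\{q|_{\bar s},\,q|_{\lfloor u\rfloor}\mid s\in G,\ q\in\mathfrak{M}^\star(Z),\ u\in\mathfrak{M}(Z)\}=\mathcal{M}(Z)\setminus\{q|_{\bar s}\mid s\in G,\ q\in\mathfrak{M}^\star(Z)\}$$ is (via the quotient map $\mathbf{k}\mathfrak{M}(Z)\to\mathbf{k}\mathfrak{M}(Z)/\langle S_\phi(Z)\cup I_A\rangle_{\mathrm{uOpAlg}}=\mathcal{F}^{\phi\text{-}\mathrm{Alg}}_{\mathrm{uAlg}}(A)$) a linear basis of the free $\phi$-algebra $\mathcal{F}^{\phi\text{-}\mathrm{Alg}}_{\mathrm{uAlg}}(A)$ over $A$.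
   Context: $\mathbf{k}$ is a field; $\mathcal{M}(Z)$ is the free monoid on $Z$. A unital operated algebra is a unital $\mathbf{k}$-algebra with a $\mathbf{k}$-linear operator $P$; an operated ideal is a (two-sided) ideal closed under the operator; $\langle S\rangle_{\mathrm{uOpAlg}}$ is the operated ideal generated by $S$. $\mathfrak{M}(Z)$ is the free operated monoid on $Z$ (bracketed words): $\mathfrak{M}(Z)=\bigcup_n\mathfrak{M}_n$ with $\mathfrak{M}_0=\mathcal{M}(Z)$, $\mathfrak{M}_{n+1}=\mathcal{M}(Z\sqcup\lfloor\mathfrak{M}_n\rfloor)$, operator $u\mapsto\lfloor u\rfloor$. $\mathbf{k}\mathfrak{M}(Z)$ is the free unital operated algebra on $Z$. Each $u\ne1$ in $\mathfrak{M}(Z)$ is uniquely a product $u_1\cdots u_n$ with $u_i\in Z\cup\lfloor\mathfrak{M}(Z)\rfloor$; its breadth is $|u|=n$, and $|1|=0$. For $\star\notin Z$, $\mathfrak{M}^\star(Z)$ is the set of elements of $\mathfrak{M}(Z\cup\{\star\})$ in which $\star$ occurs exactly once; $q|_u$ is obtained from $q$ by replacing $\star$ by $u$, extended linearly in $u$. A monomial order on $\mathfrak{M}(Z)$ is a well-order with $u<v\Rightarrow q|_u<q|_v$ for all $q\in\mathfrak{M}^\star(Z)$. The leading monomial $\bar f$ of $f\notin\mathbf{k}$ is its largest monomial; $\bar f=1$ for $f\in\mathbf{k}$. For monic $f,g$: if $w=\bar fu=v\bar g$ with $\max\{|\bar f|,|\bar g|\}<|w|<|\bar f|+|\bar g|$,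 then $fu-vg$ is an intersection composition with respect to $w$; if $w=\bar f=q|_{\bar g}$, then $f-q|_g$ is an inclusion composition with respect to $w$. An element is trivial modulo $(\mathcal{G},w)$ if it equals a finite sum $\sum_ic_iq_i|_{s_i}$ with $c_i\in\mathbf{k}$, $q_i\in\mathfrak{M}^\star(Z)$, $s_i\in\mathcal{G}$, $q_i|_{\bar s_i}<w$. $\mathcal{G}\subseteq\mathbf{k}\mathfrak{M}(Z)$ is an operated GS basis in $\mathbf{k}\mathfrak{M}(Z)$ if all compositions of (monicized) elements of $\mathcal{G}$ are trivial modulo $(\mathcal{G},w)$; it is an operated GS basis of an operated ideal if it moreover generates that operated ideal. GS bases of ideals of $\mathbf{k}\mathcal{M}(Z)$ are the usual ones for associative algebras. $\mathrm{Irr}(\mathcal{G}):=\mathfrak{M}(Z)\setminus\{q|_{\bar s}\mid s\in\mathcal{G},\ q\in\mathfrak{M}^\star(Z)\}$, with $s$ ranging over nonzero elements (likewise $s\in G$ in the claim). An OPI is an element of $\mathbf{k}\mathfrak{M}(X)$ for a set $X$. For $\phi(z)=\lfloor z\rfloor-cz\in\mathbf{k}\mathfrak{M}(\{z\})$, $S_\phi(Z):=\{\lfloor u\rfloor-cu\mid u\in\mathfrak{M}(Z)\}\subseteq\mathbf{k}\mathfrak{M}(Z)$. A $\phi$-algebra is a unital operated algebra $(B,P)$ with $P(r)-cr=0$ for all $r\in B$; $\mathcal{F}^{\phi\text{-}\mathrm{Alg}}_{\mathrm{uAlg}}$ is the left adjoint of the forgetful functor from $\phi$-algebras to unital algebras.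 Orders: $Z$ is equipped with a well-order $\le_Z$. On $\mathcal{M}(Z)$, $u<_{\mathrm{dlex}}v$ if $u$ is shorter than $v$, or they have the same length and $u=mu_in$, $v=mv_in'$ with $m,n,n'\in\mathcal{M}(Z)$, $u_i,v_i\in Z$, $u_i<_Zv_i$. The order $\le$ is a monomial order on $\mathfrak{M}(Z)$ (that of Guo–Sit–Zhang) whose restriction to $\mathcal{M}(Z)$ is $\le_{\mathrm{dlex}}$ and for which the leading monomial of $\lfloor u\rfloor-cu$ is $\lfloor u\rfloor$ for all $u\in\mathfrak{M}(Z)$. *)

(* Defs.v *)
From HB Require Import structures.
From mathcomp Require Import all_boot all_order all_algebra.
From mathcomp Require Import boolp classical_sets.
From mathcomp Require Import finmap.
From mathcomp.multinomials Require Import monalg.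

Set Implicit Arguments.
Unset Strict Implicit.
Unset Printing Implicit Defensive.

Import GRing.Theory.

Local Open Scope classical_set_scope.
Local Open Scope ring_scope.
Local Open Scope quotient_scope.

(* Unital [k]-algebras, given as rings with a central structure morphism from
   [k].  The library's [algType] is not used because it requires [1 != 0],
   while the algebras at hand may be zero (take an ideal containing a nonzero
   constant).                                                                 *)
HB.mixin Record isUAlgebra (k : fieldType) A of GRing.PzRing A := {
  uscalar : k -> A;
  uscalar_is_zmod_morphism : zmod_morphism uscalar;
  uscalar_is_monoid_morphism : monoid_morphism uscalar;
  uscalarC : forall a x, uscalar a * x = x * uscalar a
}.

#[short(type="uAlgType")]
HB.structure Definition UAlgebra (k : fieldType) :=
  {A of GRing.PzRing A & isUAlgebra k A}.

Definition uscale (k : fieldType) (A : uAlgType k) (a : k) (x : A) : A :=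
  uscalar a * x.

Reserved Notation "a *:u x" (at level 40).
Notation "a *:u x" := (uscale a x) : ring_scope.

Definition ulinear (k : fieldType) (A B : uAlgType k) (f : A -> B) :=
  forall (a : k) (x y : A), f (a *:u x + y) = a *:u f x + f y.

HB.mixin Record hasOperator (k : fieldType) A of UAlgebra k A := {
  oper : A -> A;
  oper_is_ulinear : @ulinear k A A oper
}.

#[short(type="uOpAlgType")]
HB.structure Definition UOpAlgebra (k : fieldType) :=
  {A of UAlgebra k A & hasOperator k A}.

Definition alg_morphism (k : fieldType) (A B : uAlgType k) (f : A -> B) :=
  ulinear f /\ monoid_morphism f.

Definition opalg_morphism (k : fieldType) (A B : uOpAlgType k) (f : A -> B) :=
  alg_morphism f /\ forall x, f (oper x) = oper (f x).

Record is_ideal (R : pzRingType) (I : set R) : Prop := IsIdeal {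
  ideal0 : I 0;
  idealB : forall x y, I x -> I y -> I (x - y);
  idealMl : forall a x, I x -> I (a * x);
  idealMr : forall a x, I x -> I (x * a)
}.

Definition is_opideal (k : fieldType) (A : uOpAlgType k) (I : set A) :=
  is_ideal I /\ forall x, I x -> I (oper x).

Record ideal (R : pzRingType) :=
  Ideal { ideal_set :> set R; idealP : is_ideal ideal_set }.

Record opideal (k : fieldType) (A : uOpAlgType k) := OpIdeal {
  opideal_ideal :> ideal A;
  opideal_oper : forall x,
    ideal_set opideal_ideal x -> ideal_set opideal_ideal (oper x)
}.

Definition ideal_gen (R : pzRingType) (S : set R) : set R :=
  \bigcap_(I in [set I | is_ideal I /\ S `<=` I]) I.

Definition opideal_gen_set (k : fieldType) (A : uOpAlgType k) (S : set A) :
    set A :=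
  \bigcap_(I in [set I | is_opideal I /\ S `<=` I]) I.

Lemma opideal_gen_is_ideal (k : fieldType) (A : uOpAlgType k) (S : set A) :
  is_ideal (opideal_gen_set S).
Proof.
split=> [I [[II _] _]|x y Sx Sy I IP|a x Sx I IP|a x Sx I IP].
- exact: ideal0.
- by case: (IP) => [[II _] _]; apply: idealB => //; [apply: Sx|apply: Sy].
- by case: (IP) => [[II _] _]; apply: idealMl => //; apply: Sx.
- by case: (IP) => [[II _] _]; apply: idealMr => //; apply: Sx.
Qed.

Lemma opideal_gen_oper (k : fieldType) (A : uOpAlgType k) (S : set A) x :
  opideal_gen_set S x -> opideal_gen_set S (oper x).
Proof. by move=> Sx I IP; apply: IP.1.2; apply: Sx. Qed.

Definition opideal_gen (k : fieldType) (A : uOpAlgType k) (S : set A) :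
    opideal A :=
  @OpIdeal k A (Ideal (opideal_gen_is_ideal S)) (@opideal_gen_oper k A S).

(* Quotients by two-sided ideals.  The library only provides the additive
   quotient [Quotient.quot] in the non-commutative setting.                   *)
Definition ideal_pred (R : pzRingType) (I : ideal R) : {pred R} :=
  fun x => `[< ideal_set I x >].

Lemma ideal_pred_zmod_closed (R : pzRingType) (I : ideal R) :
  zmod_closed (ideal_pred I).
Proof.
have [I0 IB _ _] := idealP I; split=> [|x y].
  exact/asboolP.
by move=> /asboolP Ix /asboolP Iy; apply/asboolP/IB.
Qed.

HB.instance Definition _ (R : pzRingType) (I : ideal R) :=
  GRing.isZmodClosed.Build R (ideal_pred I) (ideal_pred_zmod_closed I).

Definition quot (R : pzRingType) (I : ideal R) : Type :=
  Quotient.quot (ideal_pred I : zmodClosed R).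

Section QuotientRing.
Context (R : pzRingType) (I : ideal R).

HB.instance Definition _ := GRing.Zmodule.on (quot I).

Definition quot_pi (x : R) : quot I :=
  \pi_(Quotient.quot (ideal_pred I : zmodClosed R)) x.
Definition quot_repr (x : quot I) : R :=
  repr (x : Quotient.quot (ideal_pred I : zmodClosed R)).

Lemma quot_reprK : cancel quot_repr quot_pi.
Proof. by move=> x; rewrite /quot_pi /quot_repr reprK. Qed.

Lemma quot_piP x y : quot_pi x = quot_pi y <-> ideal_set I (x - y).
Proof.
split=> [/eqP|Ixy].
  by rewrite /quot_pi -Quotient.idealrBE unfold_in => /asboolP.
by apply/eqP; rewrite /quot_pi -Quotient.idealrBE; apply/asboolP.
Qed.

Lemma quot_pi_is_zmod_morphism : zmod_morphism quot_pi.
Proof. by move=> x y; rewrite /quot_pi raddfB. Qed.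

HB.instance Definition _ :=
  GRing.isZmodMorphism.Build R (quot I) quot_pi quot_pi_is_zmod_morphism.

Lemma quot_repr_pi x : ideal_set I (quot_repr (quot_pi x) - x).
Proof. by apply/quot_piP; rewrite quot_reprK. Qed.

Lemma quot_ind (P : quot I -> Prop) :
  (forall x, P (quot_pi x)) -> forall x, P x.
Proof. by move=> Ppi x; rewrite -[x]quot_reprK. Qed.

Definition quot_one : quot I := quot_pi 1.
Definition quot_mul (x y : quot I) : quot I :=
  quot_pi (quot_repr x * quot_repr y).

Lemma quot_mul_pi x y : quot_mul (quot_pi x) (quot_pi y) = quot_pi (x * y).
Proof.
apply/quot_piP; set x' := quot_repr _; set y' := quot_repr _.
have -> : x' * y' - x * y = x' * (y' - y) - (x - x') * y.
  by rewrite mulrBr mulrBl opprB addrA subrK.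
apply: (idealB (idealP I)).
  exact/(idealMl (idealP I))/quot_repr_pi.
apply/(idealMr (idealP I))/quot_piP.
by rewrite quot_reprK.
Qed.

Lemma quot_mulA : associative quot_mul.
Proof.
elim/quot_ind=> x; elim/quot_ind=> y; elim/quot_ind=> z.
by rewrite !quot_mul_pi mulrA.
Qed.

Lemma quot_mul1x : left_id quot_one quot_mul.
Proof. by elim/quot_ind=> x; rewrite quot_mul_pi mul1r. Qed.

Lemma quot_mulx1 : right_id quot_one quot_mul.
Proof. by elim/quot_ind=> x; rewrite quot_mul_pi mulr1. Qed.

Lemma quot_mulDl : left_distributive quot_mul +%R.
Proof.
elim/quot_ind=> x; elim/quot_ind=> y; elim/quot_ind=> z.
by rewrite -raddfD !quot_mul_pi -raddfD mulrDl.
Qed.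

Lemma quot_mulDr : right_distributive quot_mul +%R.
Proof.
elim/quot_ind=> x; elim/quot_ind=> y; elim/quot_ind=> z.
by rewrite -raddfD !quot_mul_pi -raddfD mulrDr.
Qed.

HB.instance Definition _ := GRing.Zmodule_isPzRing.Build (quot I)
  quot_mulA quot_mul1x quot_mulx1 quot_mulDl quot_mulDr.

Lemma quot_pi_is_monoid_morphism : monoid_morphism quot_pi.
Proof. by split=> // x y; rewrite -quot_mul_pi. Qed.

HB.instance Definition _ := GRing.isMonoidMorphism.Build R (quot I) quot_pi
  quot_pi_is_monoid_morphism.

End QuotientRing.

Section QuotientAlgebra.
Context (k : fieldType) (A : uAlgType k) (I : ideal A).

Definition quot_scalar (a : k) : quot I := quot_pi I (uscalar a).

Lemma quot_scalar_is_zmod_morphism : zmod_morphism quot_scalar.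
Proof.
by move=> a b; rewrite /quot_scalar uscalar_is_zmod_morphism raddfB.
Qed.

Lemma quot_scalar_is_monoid_morphism : monoid_morphism quot_scalar.
Proof.
have [s1 sM] := @uscalar_is_monoid_morphism k A.
by split=> [|a b]; rewrite /quot_scalar ?s1 ?rmorph1 // sM rmorphM.
Qed.

Lemma quot_scalarC a x : quot_scalar a * x = x * quot_scalar a.
Proof.
by elim/quot_ind: x => x; rewrite /quot_scalar -!rmorphM uscalarC.
Qed.

HB.instance Definition _ := isUAlgebra.Build k (quot I)
  quot_scalar_is_zmod_morphism quot_scalar_is_monoid_morphism quot_scalarC.

Lemma quot_pi_is_alg_morphism : alg_morphism (quot_pi I).
Proof.
split; last exact: quot_pi_is_monoid_morphism.
by move=> a x y; rewrite rmorphD /uscale rmorphM.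
Qed.

End QuotientAlgebra.

Definition opquot (k : fieldType) (A : uOpAlgType k) (J : opideal A) : Type :=
  quot J.

Section QuotientOperatedAlgebra.
Context (k : fieldType) (A : uOpAlgType k) (J : opideal A).

HB.instance Definition _ := UAlgebra.on (opquot J).

Definition opquot_pi (x : A) : opquot J := quot_pi J x.
Definition opquot_oper (x : opquot J) : opquot J :=
  opquot_pi (oper (quot_repr (x : quot J))).

Lemma operB (x y : A) : oper (x - y) = oper x - oper y.
Proof.
have scaleN1 (z : A) : (-1) *:u z = - z.
  rewrite /uscale -[-1]sub0r uscalar_is_zmod_morphism.
  have [-> _] := @uscalar_is_monoid_morphism k A.
  have := @uscalar_is_zmod_morphism k A 0 0; rewrite !subrr => ->.
  by rewrite sub0r mulN1r.
by have := oper_is_ulinear (-1) y x; rewrite !scaleN1 !(addrC (- _)).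
Qed.

Lemma opquot_oper_pi x : opquot_oper (opquot_pi x) = opquot_pi (oper x).
Proof.
by apply/(quot_piP J); rewrite -operB; apply: opideal_oper; apply: quot_repr_pi.
Qed.

Lemma opquot_oper_is_ulinear : ulinear opquot_oper.
Proof.
move=> a x y; rewrite -[x](quot_reprK (I := J)) -[y](quot_reprK (I := J)).
move: (quot_repr x) (quot_repr y) => {}x {}y.
have piL := (quot_pi_is_alg_morphism J).1.
transitivity (opquot_oper (opquot_pi (a *:u x + y))); first by rewrite -piL.
rewrite opquot_oper_pi oper_is_ulinear [LHS]piL.
by rewrite -!/(opquot_pi _) -!opquot_oper_pi.
Qed.

HB.instance Definition _ := hasOperator.Build k (opquot J)
  opquot_oper_is_ulinear.

End QuotientOperatedAlgebra.

Section MonoidAlgebra.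
Context (k : fieldType) (K : monomType).

Lemma malgC_central (a : k) (f : {malg k[K]}) : a%:MP * f = f * a%:MP.
Proof.
rewrite !malgM_def fgmulUg fgmulgU; apply: eq_bigr => m _.
by rewrite mul1m mulm1 mulrC.
Qed.

HB.instance Definition _ := isUAlgebra.Build k {malg k[K]}
  (raddfB (@malgC K k)) (conj (mpolyC1E K k) (@mpolyCM K k)) malgC_central.

Lemma malg_uscaleE (a : k) (f : {malg k[K]}) : a *:u f = a *: f.
Proof. exact: mul_malgC. Qed.

End MonoidAlgebra.

Section LinearExtension.
Context (k : fieldType) (K L : monomType) (h : K -> L).

Definition malg_map (f : {malg k[K]}) : {malg k[L]} :=
  \sum_(m <- msupp f) f@_m *: << h m >>.

Lemma malg_map_is_linear : linear malg_map.
Proof.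
move=> a f g; pose d := (msupp f `|` msupp g)%fset.
have mapE u : (msupp u `<=` d)%fset ->
    malg_map u = \sum_(m <- d) u@_m *: << h m >>.
  move=> sud; rewrite /malg_map (big_fset_incl _ sud) //= => m _ /mcoeff_outdom->.
  exact: scale0r.
rewrite !mapE ?fsubsetUl ?fsubsetUr //; last first.
  apply: fsubset_trans (msuppD_le _ _) _.
  by rewrite fsetSU // msuppZ_le.
rewrite scaler_sumr -big_split /=; apply: eq_bigr => m _.
by rewrite mcoeffD mcoeffZ scalerDl scalerA.
Qed.

End LinearExtension.

(* Bracketed words: [{fmonom X}] is the free monoid on [X], with length [fdeg],
   and [bword Z] is the free monoid on [letter Z], i.e., on the disjoint union
   of [Z] and the brackets of bracketed words.                                *)
Inductive letter (Z : Type) : Type :=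
  | Gen of Z
  | Brk of seq (letter Z).

Section LetterChoice.
Context (Z : choiceType).

Fixpoint letter_encode (l : letter Z) : GenTree.tree Z :=
  match l with
  | Gen z => GenTree.Leaf z
  | Brk s => GenTree.Node 0 (map letter_encode s)
  end.

Fixpoint letter_decode (t : GenTree.tree Z) : letter Z :=
  match t with
  | GenTree.Leaf z => Gen z
  | GenTree.Node _ s => Brk (map letter_decode s)
  end.

Lemma letter_encodeK : cancel letter_encode letter_decode.
Proof.
hnf; fix IH 1 => -[z|s] //=; congr Brk; rewrite -map_comp.
by elim: s => [|l s IHs] //=; rewrite IH IHs.
Qed.

HB.instance Definition _ :=
  Choice.copy (letter Z) (can_type letter_encodeK).

End LetterChoice.

Notation bword Z := {fmonom (letter Z)}.

Reserved Notation "u *w v" (at level 40, left associativity).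
Notation "u *w v" := (mmul u v).

Section BracketedWords.
Context (Z : choiceType).

Definition bgen (z : Z) : bword Z := FMonom [:: Gen z].
Definition bracket (u : bword Z) : bword Z := FMonom [:: Brk (fmonom_val u)].

Definition word_incl (m : {fmonom Z}) : bword Z :=
  FMonom (map (@Gen Z) (fmonom_val m)).

(* [option Z] is [Z] with the extra symbol [None] playing the role of the
   star.                                                                      *)
Fixpoint letter_stars (l : letter (option Z)) : nat :=
  match l with
  | Gen None => 1
  | Gen (Some _) => 0
  | Brk s => sumn (map letter_stars s)
  end.

Definition stars (q : bword (option Z)) : nat :=
  sumn (map letter_stars (fmonom_val q)).

Definition star_word : Type := {q : bword (option Z) | stars q == 1%N}.

Fixpoint letter_subst (u : seq (letter Z)) (l : letter (option Z)) :
    seq (letter Z) :=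
  match l with
  | Gen None => u
  | Gen (Some z) => [:: Gen z]
  | Brk s => [:: Brk (flatten (map (letter_subst u) s))]
  end.

Definition star_subst (q : star_word) (u : bword Z) : bword Z :=
  FMonom (flatten (map (letter_subst (fmonom_val u)) (fmonom_val (val q)))).

End BracketedWords.

Section FreeOperatedAlgebra.
Context (k : fieldType) (Z : choiceType).

Definition free_oper : {malg k[bword Z]} -> {malg k[bword Z]} :=
  malg_map (@bracket Z).

Lemma free_oper_is_ulinear : ulinear free_oper.
Proof. by move=> a f g; rewrite !malg_uscaleE; apply: malg_map_is_linear. Qed.

HB.instance Definition _ := hasOperator.Build k {malg k[bword Z]}
  free_oper_is_ulinear.

End FreeOperatedAlgebra.

Definition well_order (T : Type) (le : rel T) :=
  [/\ reflexive le, antisymmetric le, transitive le, total le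
    & forall A : set T, A !=set0 -> exists2 m, A m & forall x, A x -> le m x].

Definition strict (T : eqType) (le : rel T) : rel T :=
  fun u v => (u != v) && le u v.

Definition monomial_order (Z : choiceType) (le : rel (bword Z)) :=
  well_order le /\
  forall (q : star_word Z) u v,
    strict le u v -> strict le (star_subst q u) (star_subst q v).

Definition dlex_lt (Z : choiceType) (leZ : rel Z) (u v : {fmonom Z}) : Prop :=
  (fdeg u < fdeg v)%N \/
  fdeg u = fdeg v /\
  exists (m n n' : {fmonom Z}) (x y : Z),
    [/\ u = m *w fmu x *w n, v = m *w fmu y *w n' & strict leZ x y].

Definition dlex (Z : choiceType) (leZ : rel Z) : rel {fmonom Z} :=
  fun u v => (u == v) || `[< dlex_lt leZ u v >].

(* Groebner-Shirshov bases, for a free monoid together with a set [C] of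
   contexts acting on it by [plug]: in the associative case a context is a pair
   of words, in the operated case it is a star word.                          *)
Section GroebnerShirshov.
Context (k : fieldType) (X : choiceType) (C : Type).
Context (plug : C -> {fmonom X} -> {fmonom X}) (le : rel {fmonom X}).
Implicit Types (f g h : {malg k[{fmonom X}]}) (G : set {malg k[{fmonom X}]}).
Implicit Types (w u v : {fmonom X}).

(* This is [1] for all constants, including [0]. *)
Definition lead f : {fmonom X} := last mone (sort le (msupp f)).

Definition monicize f := (f@_(lead f))^-1 *: f.

Definition plugl (q : C) f := malg_map (plug q) f.

Definition trivial_mod G w h :=
  exists (n : nat) (c : 'I_n -> k) (q : 'I_n -> C)
         (s : 'I_n -> {malg k[{fmonom X}]}),
    (forall i, G (s i) /\ strict le (plug (q i) (lead (s i))) w) /\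
    h = \sum_(i < n) c i *: plugl (q i) (s i).

Definition intersections_trivial G f g :=
  forall w u v,
    w = lead f *w u -> w = v *w lead g ->
    (maxn (fdeg (lead f)) (fdeg (lead g)) < fdeg w)%N ->
    (fdeg w < fdeg (lead f) + fdeg (lead g))%N ->
    trivial_mod G w (f * << u >> - << v >> * g).

Definition inclusions_trivial G f g :=
  forall w (q : C),
    w = lead f -> w = plug q (lead g) -> trivial_mod G w (f - plugl q g).

Definition GS_basis G :=
  forall f g, G f -> f != 0 -> G g -> g != 0 ->
    intersections_trivial G (monicize f) (monicize g) /\
    inclusions_trivial G (monicize f) (monicize g).

Definition reducible G : set {fmonom X} :=
  [set w | exists s q, [/\ G s, s != 0 & w = plug q (lead s)]].

End GroebnerShirshov.

Definition word_plug (Z : choiceType) (p : {fmonom Z} * {fmonom Z})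
    (u : {fmonom Z}) : {fmonom Z} :=
  p.1 *w u *w p.2.

Definition GS_basis_of (k : fieldType) (Z : choiceType) (le : rel {fmonom Z})
    (G I : set {malg k[{fmonom Z}]}) :=
  GS_basis (@word_plug Z) le G /\ ideal_gen G = I.

Definition operated_GS_basis_of (k : fieldType) (Z : choiceType)
    (le : rel (bword Z)) (G J : set {malg k[bword Z]}) :=
  GS_basis (@star_subst Z) le G /\ opideal_gen_set G = J.

Definition Irr (k : fieldType) (Z : choiceType) (le : rel (bword Z))
    (G : set {malg k[bword Z]}) : set (bword Z) :=
  ~` reducible (@star_subst Z) le G.

Definition alg_incl (k : fieldType) (Z : choiceType) :
    {malg k[{fmonom Z}]} -> {malg k[bword Z]} :=
  malg_map (@word_incl Z).

Definition phi_at (k : fieldType) (Z : choiceType) (c : k) (u : bword Z) :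
    {malg k[bword Z]} :=
  << bracket u >> - c *: << u >>.

Definition S_phi (k : fieldType) (Z : choiceType) (c : k) :
    set {malg k[bword Z]} :=
  range (phi_at c).

Definition is_phi_algebra (k : fieldType) (c : k) (B : uOpAlgType k) :=
  forall r : B, oper r - c *:u r = 0.

(* [(F, i)] is a universal arrow from [A] to the forgetful functor from
   phi-algebras to unital algebras, i.e., [F] is the value at [A] of the left
   adjoint and [i] is the unit.                                               *)
Definition is_free_phi_algebra (k : fieldType) (c : k) (A : uAlgType k)
    (F : uOpAlgType k) (i : A -> F) :=
  [/\ is_phi_algebra c F, alg_morphism i
    & forall (B : uOpAlgType k) (f : A -> B),
        is_phi_algebra c B -> alg_morphism f ->
        exists! g : F -> B, opalg_morphism g /\ forall a, g (i a) = f a].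

Definition is_linear_basis (k : fieldType) (V : uAlgType k) (T : choiceType)
    (J : set T) (b : T -> V) :=
  (forall (s : seq T) (a : T -> k),
     uniq s -> (forall t, t \in s -> J t) ->
     \sum_(t <- s) a t *:u b t = 0 -> forall t, t \in s -> a t = 0) /\
  (forall x : V, exists (s : seq T) (a : T -> k),
     (forall t, t \in s -> J t) /\ x = \sum_(t <- s) a t *:u b t).

(* Main.v *)
Require Import Defs.
From HB Require Import structures.
From mathcomp Require Import all_boot all_order all_algebra.
From mathcomp Require Import boolp classical_sets.
From mathcomp Require Import finmap.
From mathcomp.multinomials Require Import monalg.

(** The relations [[u] = c u] allow every bracket to be traded for the scalar
    [c], so the quotient of the bracketed-word algebra by the operated ideal
    [J] generated by them and by [IA] should be the algebra [A] itself, with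
    the operator [x |-> c x].  The proof makes this precise by a retraction and
    then reads off the basis from the classical theory of Groebner-Shirshov
    bases of associative algebras.

    The compositions.  A leading monomial [[u]] has breadth one, so it is
    involved in no intersection, and a bracket never occurs inside a
    bracket-free word.  What remains is inclusions of a leading monomial
    inside [[u]] ([bracket_inclusion]; for [s] monic with leading monomial [l]
    and [u = q|_l], the composition is a combination of [q|_s] and of the
    relations [[q|_m] - c q|_m] with [m < l], all of which lie below [[u]]), and
    the compositions inside [G], which are those of the free associative
    algebra: a star word whose value is bracket-free is a pair of
    bracket-free words around the star ([star_word_cases],
    [word_incl_factor]).

    The irreducible words.  A word is of the form [q|_[u]] exactly when it is
    not bracket-free; hence the three descriptions of [Irr].

    The quotient.  Let [retr] be the algebra morphism sending each [[u]] to
    [c] times the image of [u] and fixing the bracket-free words.  It maps [J]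
    into [IA] ([retr_opideal]), and an element differs from its retraction by
    an element of [J] ([sub_retr_opideal]).  So [retr] and the inclusion of
    words induce inverse isomorphisms between [A] and the quotient by [J].
    This quotient is a phi-algebra, and between phi-algebras every algebra
    morphism commutes with the operators, both being multiplication by [c]:
    the universal property is then that of an isomorphism.

    The basis.  Along this isomorphism, the claim is the Composition-Diamond
    lemma for words ([composition_diamond]).  Its core is that two ways of
    writing a word [w] as [a l b], with [l] the leading monomial of an element
    of [G], give the same element up to terms below [w] ([critical_pair]):
    the two occurrences are disjoint, nested or overlapping. *)

Set Implicit Arguments.
Unset Strict Implicit.
Unset Printing Implicit Defensive.

Import GRing.Theory.

Local Open Scope classical_set_scope.
Local Open Scope ring_scope.

(** * Identities in rings and modules *)

Lemma mulr_nested (R : pzRingType) (a b c d x : R) :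
  a * (b * x * c) * d = a * b * x * (c * d).
Proof. by rewrite !mulrA. Qed.

Lemma sub_cross (R : pzRingType) (l1 l2 s1 s2 m : R) :
  s1 * m * l2 - l1 * m * s2 = s1 * (m * (l2 - s2)) - (l1 - s1) * m * s2.
Proof.
by rewrite mulrBr mulrBr !mulrBl !mulrA opprB addrA subrK.
Qed.

Lemma mulr_disjoint (R : pzRingType) (a b m l1 l2 s1 s2 : R) :
  a * s1 * (m * (l2 * b)) - a * (l1 * m) * s2 * b =
  a * (s1 * m * l2 - l1 * m * s2) * b.
Proof. by rewrite mulrBr mulrBl !mulrA. Qed.

Lemma scalerD_sub (R : pzRingType) (V : lmodType R) (a b : R) (u v x : V) :
  u + v - (a + b) *: x = (u - a *: x) + (v - b *: x).
Proof. by rewrite scalerDl opprD addrACA. Qed.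

Lemma scalerP_sub (R : pzRingType) (V : lmodType R) (a : R) (u v x y : V) :
  a *: u + v - (a *: x + y) = a *: (u - x) + (v - y).
Proof. by rewrite opprD addrACA scalerBr. Qed.

Lemma mulr_overlap (R : pzRingType) (a b m n s1 s2 : R) :
  a * (s1 * n - m * s2) * b = a * s1 * (n * b) - a * m * s2 * b.
Proof. by rewrite mulrBr mulrBl !mulrA. Qed.

Lemma mulr_sub2 (R : pzRingType) (x y x' y' : R) :
  x * y - x' * y' = (x - x') * y + x' * (y - y').
Proof. by rewrite mulrBl mulrBr addrA subrK. Qed.

Lemma sub_phi (R : pzRingType) (V : lmodType R) (c : R) (x y u v : V) :
  x - c *: y - u = x - u - c *: (y - v) - c *: v.
Proof. by rewrite scalerBr opprB [c *: v - _]addrC addrA addrK addrAC. Qed.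

(** * Linear maps on monoid algebras *)

Section MalgLinear.
Context (k : fieldType) (K : monomType).

Lemma malg_sumE (f : {malg k[K]}) : f = \sum_(m <- msupp f) f@_m *: << m >>.
Proof.
rewrite [LHS]monalgE; apply: eq_bigr => m _.
by apply/malgP => m'; rewrite mcoeffZ !mcoeffU mulrnAr mulr1.
Qed.

Lemma mcoeff_sum_uniq (r : seq K) (a : K -> k) m : uniq r ->
  (\sum_(u <- r) a u *: << u >>)@_m = if m \in r then a m else 0.
Proof.
move=> r_uniq; rewrite raddf_sum /=.
rewrite (eq_bigr (fun u => if u == m then a u else 0)) => [|u _]; last first.
  by rewrite mcoeffZ mcoeffU mulr_natr; case: eqP.
case: ifPn => mr; last first.
  by rewrite big_seq big1 // => u ur; case: eqP => // um; rewrite -um ur in mr.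
rewrite (bigD1_seq m) //= eqxx big1 ?addr0 // => u /negPf->.
by [].
Qed.

Lemma malg_supp_ind (Q : {malg k[K]} -> Prop) f :
  Q 0 -> (forall a g h, Q g -> Q h -> Q (a *: g + h)) ->
  (forall m, m \in msupp f -> Q << m >>) -> Q f.
Proof.
move=> Q0 QD Qm; rewrite [f]malg_sumE big_seq.
by elim/big_rec: _ => // m g /Qm; apply: QD.
Qed.

Lemma malg_ind (Q : {malg k[K]} -> Prop) :
  Q 0 -> (forall a g h, Q g -> Q h -> Q (a *: g + h)) ->
  (forall m, Q << m >>) -> forall f, Q f.
Proof. by move=> Q0 QD Qm f; apply: malg_supp_ind. Qed.

Lemma linear_malg_ext (V : lmodType k) (F1 F2 : {linear {malg k[K]} -> V}) :
  (forall m, F1 << m >> = F2 << m >>) -> F1 =1 F2.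
Proof.
move=> F12 f; rewrite [f]malg_sumE !linear_sum; apply: eq_bigr => m _.
by rewrite !linearZ /= F12.
Qed.

Lemma malgMU (u v : K) : << u >> * << v >> = << mmul u v >> :> {malg k[K]}.
Proof. by rewrite malgM_def fgmulUU mulr1. Qed.

Lemma malg_scalerAr a (f g : {malg k[K]}) : f * (a *: g) = a *: (f * g).
Proof. by rewrite -!mul_malgC mulrA -malgC_central mulrA. Qed.

End MalgLinear.

Section MalgMap.
Context (k : fieldType) (K L : monomType) (h : K -> L).

HB.instance Definition _ := GRing.isLinear.Build k {malg k[K]} {malg k[L]} _
  (@malg_map k K L h) (@malg_map_is_linear k K L h).

Lemma malg_mapU m : malg_map h << m >> = << h m >> :> {malg k[L]}.
Proof. by rewrite /malg_map msuppU1 big_seq_fset1 mcoeffUU scale1r. Qed.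

Lemma msupp_malg_map (f : {malg k[K]}) m :
  m \in msupp (malg_map h f) -> exists2 m', m' \in msupp f & m = h m'.
Proof.
move=> fm; apply: contrapT => nm; move: fm.
rewrite -mcoeff_neq0 /malg_map raddf_sum /= big_seq big1 ?eqxx // => m' fm'.
rewrite mcoeffZ mcoeffU; case: eqP => [hm|_]; last by rewrite mulr0.
by case: nm; exists m'.
Qed.

Lemma mcoeff_malg_map (f : {malg k[K]}) m :
  injective h -> (malg_map h f)@_(h m) = f@_m.
Proof.
move=> hI; rewrite {2}[f]malg_sumE /malg_map !raddf_sum /=.
by apply: eq_bigr => m' _; rewrite !mcoeffZ !mcoeffU (inj_eq hI).
Qed.
End MalgMap.

Lemma malg_map_comp (k : fieldType) (K L M : monomType) (h : K -> L)
    (g : L -> M) (f : {malg k[K]}) :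
  malg_map g (malg_map h f) = malg_map (g \o h) f.
Proof.
by rewrite {2}/malg_map linear_sum; apply: eq_bigr => m _;
  rewrite linearZ /= malg_mapU.
Qed.

(** Both sides of the multiplicativity identity are bilinear, so it can be
    tested on monomials. *)
Lemma linear_malg_mul (k : fieldType) (K L : monomType)
    (F : {linear {malg k[K]} -> {malg k[L]}}) :
  (forall u v, F << mmul u v >> = F << u >> * F << v >>) ->
  forall f g, F (f * g) = F f * F g.
Proof.
move=> FM f g.
elim/malg_ind: f => [|a f1 f2 IH1 IH2|u].
- by rewrite mul0r linear0 mul0r.
- by rewrite mulrDl -scalerAl linearP IH1 IH2 linearP mulrDl -scalerAl.
elim/malg_ind: g => [|a g1 g2 IH1 IH2|v].
- by rewrite mulr0 linear0 mulr0.
- by rewrite mulrDr malg_scalerAr !linearP IH1 IH2 mulrDr malg_scalerAr.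
by rewrite malgMU FM.
Qed.

Lemma quot_piZ (k : fieldType) (K : monomType) (I : ideal {malg k[K]}) a f :
  a *:u quot_pi I f = quot_pi I (a *: f).
Proof. by rewrite /uscale -rmorphM /= mul_malgC. Qed.

(** * Leading monomials *)

Section Lead.
Context (k : fieldType) (X : choiceType) (le : rel {fmonom X}).
Hypothesis le_refl : reflexive le.
Hypothesis le_anti : antisymmetric le.
Hypothesis le_trans : transitive le.
Hypothesis le_total : total le.
Implicit Types (f g : {malg k[{fmonom X}]}) (u v w : {fmonom X}).

Lemma lead0 : lead le (0 : {malg k[{fmonom X}]}) = mone.
Proof.
have size0 : size (sort le (msupp (0 : {malg k[{fmonom X}]}))) = 0%N.
  by rewrite size_sort msupp0 cardfs0.
by rewrite /lead (size0nil size0).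
Qed.

Lemma lead_supp f : f != 0 -> lead le f \in msupp f.
Proof.
rewrite -msupp_eq0 /lead => f0.
rewrite -(mem_sort le); case: (sort le (msupp f)) (mem_sort le (msupp f)).
  by move=> sf; case/eqP: f0; apply/fsetP => m; rewrite -sf.
by move=> m s _ /=; apply: mem_last.
Qed.

Lemma lead_max f m : m \in msupp f -> le m (lead le f).
Proof.
rewrite /lead -(mem_sort le); have := sort_sorted le_total (msupp f).
case/lastP: (sort le (msupp f)) => // s x; rewrite last_rcons mem_rcons inE.
move=> sorted_s /predU1P[->|ms]; first exact: le_refl.
have /(sorted_ltn_nth le_trans m) sP := sorted_s.
have := sP (index m s) (size s); rewrite !inE size_rcons !nth_rcons ltnn eqxx.
rewrite index_mem ms nth_index //; apply; rewrite ?index_mem //.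
by rewrite (ltn_trans _ (ltnSn _)) ?index_mem.
Qed.

Lemma lead_unique f m :
  m \in msupp f -> (forall m', m' \in msupp f -> le m' m) -> lead le f = m.
Proof.
move=> fm mM; have f0: f != 0.
  by rewrite -msupp_eq0; apply/eqP => f0; rewrite f0 in fm.
by apply: le_anti; rewrite lead_max // mM // lead_supp.
Qed.

Lemma leadZ a f : a != 0 -> lead le (a *: f) = lead le f.
Proof. by move=> a0; rewrite /lead msuppZ (negPf a0). Qed.

Lemma lead_coef_neq0 f : f != 0 -> f@_(lead le f) != 0.
Proof. by move=> f0; rewrite mcoeff_neq0 lead_supp. Qed.

Lemma monicizeE f : monicize le f = (f@_(lead le f))^-1 *: f.
Proof. by []. Qed.

Lemma monicizeK f : f != 0 -> f = f@_(lead le f) *: monicize le f.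
Proof. by move=> f0; rewrite scalerA divff ?scale1r ?lead_coef_neq0. Qed.

Lemma lead_monicize f : f != 0 -> lead le (monicize le f) = lead le f.
Proof. by move=> f0; rewrite leadZ ?invr_eq0 ?lead_coef_neq0. Qed.

(** The lower terms of a monic element: rewriting its leading monomial
    replaces a word by smaller ones. *)
Lemma monicize_tail f m : f != 0 ->
  m \in msupp (<< lead le f >> - monicize le f) -> strict le m (lead le f).
Proof.
move=> f0; rewrite -mcoeff_neq0 mcoeffB mcoeffZ mcoeffU /strict.
have [->|mN] := eqVneq m (lead le f).
  by rewrite mulVf ?lead_coef_neq0 // subrr eqxx.
rewrite sub0r oppr_eq0 mulf_eq0 negb_or => /andP[_].
by rewrite mcoeff_neq0 => /lead_max ->.
Qed.

End Lead.

(** * Combinations of plugged elements *)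

Section Plug.
Context (k : fieldType) (X : choiceType) (C : Type).
Context (plug : C -> {fmonom X} -> {fmonom X}).
Implicit Types (f g : {malg k[{fmonom X}]}).

Lemma plugl0 q : plugl plug q (0 : {malg k[{fmonom X}]}) = 0.
Proof. exact: linear0. Qed.

Lemma pluglB q f g : plugl plug q (f - g) = plugl plug q f - plugl plug q g.
Proof. exact: linearB. Qed.

Lemma pluglZ q a f : plugl plug q (a *: f) = a *: plugl plug q f.
Proof. exact: linearZ. Qed.

Lemma pluglP q a f g :
  plugl plug q (a *: f + g) = a *: plugl plug q f + plugl plug q g.
Proof. exact: linearP. Qed.

Lemma pluglU q m :
  plugl plug q << m >> = << plug q m >> :> {malg k[{fmonom X}]}.
Proof. exact: malg_mapU. Qed.

End Plug.

Section Span.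
Context (k : fieldType) (X : choiceType) (C : Type).
Context (plug : C -> {fmonom X} -> {fmonom X}) (le : rel {fmonom X}).
Context (G : set {malg k[{fmonom X}]}).
Implicit Types (P : {fmonom X} -> Prop) (f g h : {malg k[{fmonom X}]}).

(** The combinations of elements [q|_s] in the definition of triviality, with
    the bound on [q|_(lead s)] replaced by an arbitrary condition [P]: besides
    strict bounds, the Composition-Diamond lemma needs large bounds and no
    bound at all. *)
Definition gs_span P h :=
  exists (n : nat) (c : 'I_n -> k) (q : 'I_n -> C)
         (s : 'I_n -> {malg k[{fmonom X}]}),
    (forall i, G (s i) /\ P (plug (q i) (lead le (s i)))) /\
    h = \sum_(i < n) c i *: plugl plug (q i) (s i).

Lemma trivial_modE w h :
  trivial_mod plug le G w h = gs_span (fun u => strict le u w) h.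
Proof. by []. Qed.

Lemma gs_span0 P : gs_span P 0.
Proof.
exists 0%N, (fun _ => 0).
exists (fun i : 'I_0 => False_rect C (notF (ltn_ord i))), (fun _ => 0).
by split=> [[]//|]; rewrite big_ord0.
Qed.

Lemma gs_spanU P c q s :
  G s -> P (plug q (lead le s)) -> gs_span P (c *: plugl plug q s).
Proof.
move=> Gs Pq; exists 1%N, (fun _ => c), (fun _ => q), (fun _ => s).
by rewrite big_ord1.
Qed.

Lemma gs_spanD P f g : gs_span P f -> gs_span P g -> gs_span P (f + g).
Proof.
move=> [n [c [q [s [sP ->]]]]] [n' [c' [q' [s' [sP' ->]]]]].
pose glue T (a : 'I_n -> T) (b : 'I_n' -> T) i :=
  match split i with inl j => a j | inr j => b j end.
have splitL (i : 'I_n) : split (lshift n' i) = inl i := unsplitK (inl i).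
have splitR (i : 'I_n') : split (rshift n i) = inr i := unsplitK (inr i).
exists (n + n')%N, (glue _ c c'), (glue _ q q'), (glue _ s s'); split.
  by move=> i; rewrite /glue; case: split => j; [apply: sP|apply: sP'].
rewrite big_split_ord; apply: f_equal2; apply: eq_bigr => i _.
  by rewrite /glue splitL.
by rewrite /glue splitR.
Qed.

Lemma gs_span_ind P (Q : {malg k[{fmonom X}]} -> Prop) :
  Q 0 -> (forall f g, Q f -> Q g -> Q (f + g)) ->
  (forall c q s, G s -> P (plug q (lead le s)) -> Q (c *: plugl plug q s)) ->
  forall f, gs_span P f -> Q f.
Proof.
move=> Q0 QD QU f [n [c [q [s [sP ->]]]]].
by elim/big_ind: _ => // i _; case: (sP i) => Gs Ps; apply: QU.
Qed.

Lemma gs_span_sub P P' f :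
  (forall w, P w -> P' w) -> gs_span P f -> gs_span P' f.
Proof.
move=> PP'; elim/gs_span_ind => [|g h|c q s Gs Ps]; first exact: gs_span0.
  exact: gs_spanD.
by apply: gs_spanU => //; apply: PP'.
Qed.

Lemma gs_spanZ P a f : gs_span P f -> gs_span P (a *: f).
Proof.
elim/gs_span_ind => [|g h sg sh|c q s Gs Ps].
- by rewrite scaler0; apply: gs_span0.
- by rewrite scalerDr; apply: gs_spanD.
by rewrite scalerA; apply: gs_spanU.
Qed.

Lemma gs_spanN P f : gs_span P f -> gs_span P (- f).
Proof. by rewrite -scaleN1r; apply: gs_spanZ. Qed.

Lemma gs_spanB P f g : gs_span P f -> gs_span P g -> gs_span P (f - g).
Proof. by move=> sf sg; apply/gs_spanD/gs_spanN. Qed.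

Lemma gs_span_sum P (I : choiceType) (r : seq I)
    (F : I -> {malg k[{fmonom X}]}) :
  (forall i, i \in r -> gs_span P (F i)) -> gs_span P (\sum_(i <- r) F i).
Proof.
move=> FP; rewrite big_seq; elim/big_ind: _ => //; first exact: gs_span0.
by move=> *; apply: gs_spanD.
Qed.

(** Finitely many words have a largest one; the zero combination is set apart
    because there may be no word satisfying [P]. *)
Lemma gs_span_bound P f : total le -> transitive le ->
  gs_span P f -> f = 0 \/ exists2 w, P w & gs_span (fun u => le u w) f.
Proof.
move=> le_total le_trans.
have le_refl u : le u u by case/orP: (le_total u u).
elim/gs_span_ind => [|f1 f2|c q s Gs Ps]; first by left.
  move=> [->|[w1 Pw1 s1]]; first by rewrite add0r.
  move=> [->|[w2 Pw2 s2]]; first by rewrite addr0; right; exists w1.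
  right; case/orP: (le_total w1 w2) => le12.
    exists w2 => //; apply: gs_spanD => //; apply: gs_span_sub s1 => u uw1.
    exact: le_trans le12.
  exists w1 => //; apply: gs_spanD => //; apply: gs_span_sub s2 => u uw2.
  exact: le_trans le12.
by right; exists (plug q (lead le s)) => //; apply: gs_spanU.
Qed.

End Span.

Lemma gs_span_map (k : fieldType) (X Y : choiceType) (C D : Type)
    (plug : C -> {fmonom X} -> {fmonom X}) (le : rel {fmonom X})
    (G : set {malg k[{fmonom X}]})
    (plug' : D -> {fmonom Y} -> {fmonom Y}) (le' : rel {fmonom Y})
    (G' : set {malg k[{fmonom Y}]})
    (F : {linear {malg k[{fmonom X}]} -> {malg k[{fmonom Y}]}}) P P' f :
  (forall q s, G s -> P (plug q (lead le s)) ->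
     exists q' s', [/\ G' s', P' (plug' q' (lead le' s')) &
       F (plugl plug q s) = plugl plug' q' s']) ->
  gs_span plug le G P f -> gs_span plug' le' G' P' (F f).
Proof.
move=> FP; elim/gs_span_ind => [|g h sg sh|c q s Gs Ps].
- by rewrite linear0; apply: gs_span0.
- by rewrite linearD; apply: gs_spanD.
rewrite linearZ /=; have [q' [s' [Gs' Ps' ->]]] := FP q s Gs Ps.
exact: gs_spanU.
Qed.

(** * The Composition-Diamond lemma for words *)

Section WellOrder.
Context (T : eqType) (le : rel T).

Lemma well_order_ind (Q : T -> Prop) : well_order le ->
  (forall w, (forall u, strict le u w -> Q u) -> Q w) -> forall w, Q w.
Proof.
move=> [_ le_anti _ le_total le_min] IH w; apply: contrapT => Qw.
have [m Qm mP] := le_min [set w | ~ Q w] (ex_intro _ w Qw).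
apply/Qm/IH => u /andP[um le_um]; apply: contrapT => Qu.
by move/eqP: um; apply; apply: le_anti; rewrite le_um mP.
Qed.

(** By totality, distinct elements are strictly comparable, and so are their
    images. *)
Lemma strict_mono_inj (h : T -> T) : reflexive le -> total le ->
  (forall u v, strict le u v -> strict le (h u) (h v)) -> injective h.
Proof.
move=> le_refl le_total hP u v huv; apply/eqP/negPn/negP => uv.
have [le_uv|le_vu] := orP (le_total u v).
  by have /hP := (introT andP (conj uv le_uv)); rewrite /strict huv eqxx.
rewrite eq_sym in uv.
by have /hP := (introT andP (conj uv le_vu)); rewrite /strict huv eqxx.
Qed.

End WellOrder.

(** Levi's lemma: of two prefixes of a word, the shorter one is a prefix of
    the other.  It locates two occurrences of leading monomials relatively to
    each other. *)
Lemma fmonom_levi (X : choiceType) (u v u' v' : {fmonom X}) :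
  u *w v = u' *w v' -> (fdeg u <= fdeg u')%N ->
  exists2 m, u' = u *w m & v = m *w v'.
Proof.
move=> /(congr1 (@fmonom_val X)); rewrite !fmM /= => uv le_uu'.
have u'E : fmonom_val u' = u ++ drop (size u) u'.
  rewrite -{1}[u : seq X](take_size_cat v (erefl _)) uv takel_cat //.
  by rewrite cat_take_drop.
exists (FMonom (drop (size u) u')); apply/eqP; rewrite fmP fmM /=.
  exact/eqP.
by move/eqP: uv; rewrite {1}u'E -catA eqseq_cat // eqxx.
Qed.

Section Words.
Context (k : fieldType) (Z : choiceType).
Implicit Types (f g : {malg k[{fmonom Z}]}) (p q : {fmonom Z} * {fmonom Z}).

Lemma plugl_word p f : plugl (@word_plug Z) p f = << p.1 >> * f * << p.2 >>.
Proof.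
elim/malg_ind: f => [|a g h IHg IHh|m].
- by rewrite plugl0 mulr0 mul0r.
- by rewrite pluglP mulrDr malg_scalerAr mulrDl -scalerAl IHg IHh.
by rewrite pluglU !malgMU.
Qed.

Lemma plugl_word_comp p q f :
  plugl (@word_plug Z) p (plugl (@word_plug Z) q f) =
  plugl (@word_plug Z) (p.1 *w q.1, q.2 *w p.2) f.
Proof.
rewrite !plugl_word -(malgMU _ p.1) -(malgMU _ q.2).
exact: mulr_nested.
Qed.

End Words.

Section Diamond.
Context (k : fieldType) (Z : choiceType) (le : rel {fmonom Z}).
Context (G : set {malg k[{fmonom Z}]}).
Hypothesis le_wo : well_order le.
Hypothesis le_plug : forall p u v,
  strict le u v -> strict le (word_plug p u) (word_plug p v).
Hypothesis G_GS : GS_basis (@word_plug Z) le G.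
Implicit Types (f g s t : {malg k[{fmonom Z}]}) (u v w : {fmonom Z}).
Implicit Types (p q : {fmonom Z} * {fmonom Z}) (P : {fmonom Z} -> Prop).

Local Notation plug := (@word_plug Z).
Local Notation lead := (lead le).
Local Notation monic := (monicize le).
Local Notation span := (gs_span plug le G).
Local Notation below w := (fun u => strict le u w).

Let le_refl : reflexive le. Proof. by case: le_wo. Qed.
Let le_anti : antisymmetric le. Proof. by case: le_wo. Qed.
Let le_trans : transitive le. Proof. by case: le_wo. Qed.
Let le_total : total le. Proof. by case: le_wo. Qed.

Let plug_inj p : injective (plug p).
Proof. exact/(strict_mono_inj le_refl le_total)/le_plug. Qed.

Let plug_le p u v : le u v -> le (plug p u) (plug p v).
Proof.
have [->|uv] := eqVneq u v; first by [].
by move=> le_uv; have /andP[] := le_plug p (introT andP (conj uv le_uv)).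
Qed.

Lemma span_plug p w f :
  span (below w) f -> span (below (plug p w)) (plugl plug p f).
Proof.
apply: (gs_span_map (F := malg_map (plug p))) => q s Gs /(le_plug p) qP.
exists (p.1 *w q.1, q.2 *w p.2), s; split.
- exact: Gs.
- by move: qP; rewrite /word_plug /= !mulmA.
by rewrite -plugl_word_comp.
Qed.

Lemma span_mull P s t p :
  G s -> (forall m, m \in msupp t -> P (lead s *w plug p m)) ->
  span P (monic s * plugl plug p t).
Proof.
move=> Gs tP; rewrite [t]malg_sumE /plugl linear_sum mulr_sumr.
apply: gs_span_sum => m /tP mP; rewrite linearZ /= malg_mapU malg_scalerAr.
apply: gs_spanZ; rewrite monicizeE -scalerAl; apply: gs_spanZ.
rewrite -[X in span _ X]scale1r.
have -> : s * << plug p m >> = plugl plug (mone, plug p m) s.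
  by rewrite plugl_word mul1r.
by apply: gs_spanU => //; rewrite {1}/word_plug mul1m.
Qed.

Lemma span_mulr P s t p :
  G s -> (forall m, m \in msupp t -> P (plug p m *w lead s)) ->
  span P (plugl plug p t * monic s).
Proof.
move=> Gs tP; rewrite [t]malg_sumE /plugl linear_sum mulr_suml.
apply: gs_span_sum => m /tP mP; rewrite linearZ /= malg_mapU -scalerAl.
apply: gs_spanZ; rewrite monicizeE malg_scalerAr; apply: gs_spanZ.
rewrite -[X in span _ X]scale1r.
have -> : << plug p m >> * s = plugl plug (plug p m, mone) s.
  by rewrite plugl_word mulr1.
by apply: gs_spanU => //; rewrite {1}/word_plug mulm1.
Qed.

Lemma GS_inclusion s1 s2 q : G s1 -> s1 != 0 -> G s2 -> s2 != 0 ->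
  lead s1 = plug q (lead s2) ->
  span (below (lead s1)) (monic s1 - plugl plug q (monic s2)).
Proof.
move=> Gs1 s1N0 Gs2 s2N0 eq_l; have [_ incl] := G_GS Gs1 s1N0 Gs2 s2N0.
have lead1 := lead_monicize le s1N0; have lead2 := lead_monicize le s2N0.
exact: incl _ q (esym lead1) (etrans eq_l (congr1 (plug q) (esym lead2))).
Qed.

Lemma GS_intersection s1 s2 u v : G s1 -> s1 != 0 -> G s2 -> s2 != 0 ->
  lead s1 *w u = v *w lead s2 ->
  (maxn (fdeg (lead s1)) (fdeg (lead s2)) < fdeg (lead s1 *w u))%N ->
  (fdeg (lead s1 *w u) < fdeg (lead s1) + fdeg (lead s2))%N ->
  span (below (lead s1 *w u)) (monic s1 * << u >> - << v >> * monic s2).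
Proof.
move=> Gs1 s1N0 Gs2 s2N0 eq_w lt_max lt_sum.
have [inter _] := G_GS Gs1 s1N0 Gs2 s2N0.
have lead1 := lead_monicize le s1N0; have lead2 := lead_monicize le s2N0.
apply: (inter _ u v (congr1 (mmul^~ u) (esym lead1))
  (etrans eq_w (congr1 (mmul v) (esym lead2)))).
  exact: (eq_ind_r (fun n => (n < _)%N) lt_max
    (congr2 (fun a b => maxn (fdeg a) (fdeg b)) lead1 lead2)).
exact: (eq_ind_r (fun n => (_ < n)%N) lt_sum
  (congr2 (fun a b => fdeg a + fdeg b)%N lead1 lead2)).
Qed.

(** Disjoint occurrences [l1 m l2]: both ways of rewriting reach the product
    of the two tails, because with [t_i = l_i - s_i] one has
    [s1 m l2 - l1 m s2 = s1 m t2 - t1 m s2]. *)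
Lemma disjoint_pair s1 s2 m : G s1 -> s1 != 0 -> G s2 -> s2 != 0 ->
  span (below (lead s1 *w m *w lead s2))
    (monic s1 * << m >> * << lead s2 >> - << lead s1 >> * << m >> * monic s2).
Proof.
move=> Gs1 s1N0 Gs2 s2N0.
pose t1 := << lead s1 >> - monic s1; pose t2 := << lead s2 >> - monic s2.
have -> : monic s1 * << m >> * << lead s2 >> -
    << lead s1 >> * << m >> * monic s2 =
  monic s1 * plugl plug (m, mone) t2 - plugl plug (mone, m) t1 * monic s2.
  have -> : plugl plug (m, mone) t2 = << m >> * t2 by rewrite plugl_word mulr1.
  have -> : plugl plug (mone, m) t1 = t1 * << m >> by rewrite plugl_word mul1r.
  exact: sub_cross.
apply: gs_spanB.
  apply: span_mull => // x /(monicize_tail le_refl le_trans le_total s2N0).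
  by move=> /(le_plug (lead s1 *w m, mone)); rewrite /word_plug !mulm1 !mulmA.
apply: span_mulr => // x /(monicize_tail le_refl le_trans le_total s1N0).
by move=> /(le_plug (mone, m *w lead s2)); rewrite /word_plug !mul1m !mulmA.
Qed.

(** With the first occurrence starting no later than the second, Levi's lemma
    leaves four configurations: the occurrences are disjoint, the second is
    inside the first, the first is a prefix of the second, or they overlap
    properly, on a nonempty word [n].  The last three are compositions placed
    in a context. *)
Lemma critical_pair_le p1 p2 s1 s2 : G s1 -> s1 != 0 -> G s2 -> s2 != 0 ->
  plug p1 (lead s1) = plug p2 (lead s2) -> (fdeg p1.1 <= fdeg p2.1)%N ->
  span (below (plug p1 (lead s1)))
    (plugl plug p1 (monic s1) - plugl plug p2 (monic s2)).
Proof.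
case: p1 p2 => [a1 b1] [a2 b2] Gs1 s1N0 Gs2 s2N0.
rewrite {1 2}/word_plug /= -!mulmA => eq_w le_a.
have [m eq_a2 eq_r] := fmonom_levi eq_w le_a; rewrite {}eq_a2 {a2 le_a eq_w}.
have [le_l1m|lt_ml1] := leqP (fdeg (lead s1)) (fdeg m).
  have [m' -> eq_b1] := fmonom_levi eq_r le_l1m.
  rewrite {}eq_b1 {eq_r b1 le_l1m m}.
  have -> : plug (a1, m' *w (lead s2 *w b2)) (lead s1) =
      plug (a1, b2) (lead s1 *w m' *w lead s2).
    by rewrite /word_plug /= !mulmA.
  have -> : plugl plug (a1, m' *w (lead s2 *w b2)) (monic s1) -
      plugl plug (a1 *w (lead s1 *w m'), b2) (monic s2) =
      plugl plug (a1, b2) (monic s1 * << m' >> * << lead s2 >> -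
        << lead s1 >> * << m' >> * monic s2).
    rewrite !plugl_word /= -(malgMU _ m') -(malgMU _ _ b2) -(malgMU _ a1).
    rewrite -(malgMU _ _ m'); exact: mulr_disjoint.
  exact/span_plug/disjoint_pair.
have [n eq_l1 eq_r2] := fmonom_levi (esym eq_r) (ltnW lt_ml1).
have [le_l2n|lt_nl2] := leqP (fdeg (lead s2)) (fdeg n).
  have [n' eq_n eq_b2] := fmonom_levi eq_r2 le_l2n.
  have eq_l : lead s1 = plug (m, n') (lead s2).
    by rewrite eq_l1 eq_n /word_plug mulmA.
  have := span_plug (a1, b1) (GS_inclusion Gs1 s1N0 Gs2 s2N0 eq_l).
  by rewrite pluglB plugl_word_comp /= eq_b2.
have [n' eq_l2 eq_b1] := fmonom_levi (esym eq_r2) (ltnW lt_nl2).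
rewrite {eq_r eq_r2}.
have [m1|mN1] := eqVneq m mone.
  have eq_l : lead s2 = plug (mone, n') (lead s1).
    by rewrite eq_l2 eq_l1 m1 /word_plug !mul1m.
  have := gs_spanN (span_plug (a1, b2) (GS_inclusion Gs2 s2N0 Gs1 s1N0 eq_l)).
  rewrite pluglB opprB plugl_word_comp /= m1 !mulm1 -eq_b1.
  by rewrite eq_l /word_plug /= mul1m eq_b1 !mulmA.
have eq_w : lead s1 *w n' = m *w lead s2 by rewrite eq_l1 eq_l2 mulmA.
have m_gt0 : (0 < fdeg m)%N by rewrite lt0n fdeg_eq0.
have n_gt0 : (0 < fdeg n)%N.
  by move: lt_ml1; rewrite eq_l1 fdegM -{1}[fdeg m]addn0 ltn_add2l.
have n'_gt0 : (0 < fdeg n')%N.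
  by move: lt_nl2; rewrite eq_l2 fdegM -{1}[fdeg n]addn0 ltn_add2l.
have lt_max : (maxn (fdeg (lead s1)) (fdeg (lead s2)) < fdeg (lead s1 *w n'))%N.
  rewrite gtn_max {2}eq_w !fdegM -{1}[fdeg (lead s1)]addn0 ltn_add2l n'_gt0.
  by rewrite -{1}[fdeg (lead s2)]add0n ltn_add2r.
have lt_sum : (fdeg (lead s1 *w n') < fdeg (lead s1) + fdeg (lead s2))%N.
  by rewrite fdegM ltn_add2l eq_l2 fdegM -{1}[fdeg n']add0n ltn_add2r.
have := span_plug (a1, b2)
  (GS_intersection Gs1 s1N0 Gs2 s2N0 eq_w lt_max lt_sum).
have -> : plug (a1, b2) (lead s1 *w n') = plug (a1, b1) (lead s1).
  by rewrite /word_plug eq_b1 /= !mulmA.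
have -> // : plugl plug (a1, b2) (monic s1 * << n' >> - << m >> * monic s2) =
  plugl plug (a1, b1) (monic s1) - plugl plug (a1 *w m, b2) (monic s2).
rewrite !plugl_word eq_b1 -(malgMU _ n' b2) -(malgMU _ a1 m).
exact: mulr_overlap.
Qed.

Lemma critical_pair p1 p2 s1 s2 : G s1 -> s1 != 0 -> G s2 -> s2 != 0 ->
  plug p1 (lead s1) = plug p2 (lead s2) ->
  span (below (plug p1 (lead s1)))
    (plugl plug p1 (monic s1) - plugl plug p2 (monic s2)).
Proof.
move=> Gs1 s1N0 Gs2 s2N0 eq_w.
have [le_p|/ltnW le_p] := leqP (fdeg p1.1) (fdeg p2.1).
  exact: critical_pair_le.
rewrite eq_w -opprB; apply/gs_spanN/critical_pair_le => //.
Qed.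

Lemma coef_plugl_monic q s : s != 0 ->
  (plugl plug q (monic s))@_(plug q (lead s)) = 1.
Proof.
move=> sN0; rewrite /plugl mcoeff_malg_map; last exact: plug_inj.
by rewrite monicizeE mcoeffZ mulVf // lead_coef_neq0.
Qed.

(** Cancellations may remove monomials from a combination but never create
    monomials larger than all the leading ones. *)
Lemma span_supp_le P f m : (forall u v, le u v -> P v -> P u) ->
  span P f -> m \in msupp f -> P m.
Proof.
move=> P_down spf; move: f spf m.
apply: gs_span_ind => [m|f g IHf IHg m|c q s Gs Ps m]; first by rewrite msupp0.
  by move/(fsubsetP (msuppD_le _ _)); rewrite inE => /orP[/IHf|/IHg].
move/(fsubsetP (msuppZ_le _ _)) => /msupp_malg_map[m' sm' ->].
by apply: P_down Ps; apply/plug_le/lead_max.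
Qed.

(** By [critical_pair], the terms whose leading monomial is exactly [w] can all
    be replaced by multiples of a single one of them, modulo terms below [w]. *)
Lemma span_le_cases w f : span (fun u => le u w) f ->
  span (below w) f \/
  exists q s a, [/\ G s, s != 0, plug q (lead s) = w
    & span (below w) (f - a *: plugl plug q (monic s))].
Proof.
have [[q0 [s0 [Gs0 s0N0 eq_w]]]|irr_w] :=
  pselect (exists q s, [/\ G s, s != 0 & plug q (lead s) = w]).
  move=> spf; right; exists q0, s0.
  suff [a spa] : exists a, span (below w) (f - a *: plugl plug q0 (monic s0)).
    by exists a.
  elim/gs_span_ind: f / spf => [|f g [a spa] [b spb]|c q s Gs le_w].
  - by exists 0; rewrite scale0r subr0; apply: gs_span0.
  - exists (a + b); rewrite scalerD_sub; exact: gs_spanD spa spb.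
  have [->|sN0] := eqVneq s 0.
    by exists 0; rewrite plugl0 scaler0 scale0r subr0; apply: gs_span0.
  have [eq_qs|neq_w] := eqVneq (plug q (lead s)) w; last first.
    exists 0; rewrite scale0r subr0; apply: gs_spanU => //.
    by rewrite /strict neq_w.
  exists (c * s@_(lead s)).
  rewrite {1}[s](monicizeK le sN0) pluglZ scalerA -scalerBr; apply: gs_spanZ.
  by rewrite -eq_qs; apply: critical_pair; rewrite ?eq_qs.
move: f.
apply: gs_span_ind => [|f g [sf|[q [s [a [Gs sN0 eq_w _]]]]]|c q s Gs le_w].
- by left; apply: gs_span0.
- move=> [sg|[q [s [a [Gs sN0 eq_w _]]]]]; last by case: irr_w; exists q, s.
  by left; apply: gs_spanD.
- by case: irr_w; exists q, s.
left; have [->|sN0] := eqVneq s 0.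
  by rewrite plugl0 scaler0; apply: gs_span0.
apply: gs_spanU => //; rewrite /strict le_w andbT; apply/eqP => eq_w.
by case: irr_w; exists q, s.
Qed.

(** Induction on a bound [w] of the terms: either the terms at [w] cancel, and
    the bound decreases, or one term survives at [w], and then [w] is the
    leading monomial. *)
Lemma lead_span_reducible f :
  span (fun _ => True) f -> f != 0 -> reducible plug le G (lead f).
Proof.
move=> /(gs_span_bound le_total le_trans) [->|[w _]]; first by rewrite eqxx.
move: w f; apply: (well_order_ind le_wo) => w IH f spf fN0.
have lower : span (below w) f -> reducible plug le G (lead f).
  move=> /(gs_span_bound le_total le_trans) [f0|[w' lt_w' spf']].
    by rewrite f0 eqxx in fN0.
  exact: IH lt_w' f spf' fN0.
have [/lower//|[q [s [a [Gs sN0 eq_w spg]]]]] := span_le_cases spf.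
have [a0|aN0] := eqVneq a 0.
  by apply: lower; rewrite a0 scale0r subr0 in spg.
exists s, q; split => //; rewrite eq_w.
apply: lead_unique => //; last first.
  by move=> m; apply: (span_supp_le _ spf) => u v; apply: le_trans.
set g := f - _ in spg; have -> : f = g + a *: plugl plug q (monic s).
  by rewrite subrK.
rewrite -mcoeff_neq0 mcoeffD mcoeffZ -eq_w coef_plugl_monic // mulr1.
have down u v : le u v -> strict le v w -> strict le u w.
  move=> le_uv /andP[vw le_vw]; rewrite /strict (le_trans le_uv le_vw) andbT.
  apply: contraNneq vw => uw; apply/eqP/le_anti.
  by rewrite le_vw -uw le_uv.
rewrite mcoeff_outdom ?add0r ?oner_eq0 // eq_w.
by apply/negP => /(span_supp_le down spg); rewrite /strict eqxx.
Qed.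

Lemma ideal_gen_span f : ideal_gen G f -> span (fun _ => True) f.
Proof.
apply; split; last first.
  move=> s Gs /=; rewrite -[s]scale1r -[s]mulr1 -[X in X * 1]mul1r.
  have -> : 1 * s * 1 = plugl plug (mone, mone) s by rewrite plugl_word.
  exact: gs_spanU.
split=> [|f1 f2|g f1 spf|g f1 spf]; first exact: gs_span0.
- exact: gs_spanB.
- elim/malg_ind: g => [|a g h IHg IHh|m].
  + by rewrite mul0r; apply: gs_span0.
  + by rewrite mulrDl -scalerAl; exact: gs_spanD (gs_spanZ a IHg) IHh.
  have -> : << m >> * f1 = plugl plug (m, mone) f1 by rewrite plugl_word mulr1.
  apply: (gs_span_map (F := malg_map (plug (m, mone)))) spf => q s Gs _.
  by exists (m *w q.1, q.2 *w mone), s; split; [| |apply: plugl_word_comp].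
elim/malg_ind: g => [|a g h IHg IHh|m].
- by rewrite mulr0; apply: gs_span0.
- by rewrite mulrDr malg_scalerAr; exact: gs_spanD (gs_spanZ a IHg) IHh.
have -> : f1 * << m >> = plugl plug (mone, m) f1 by rewrite plugl_word mul1r.
apply: (gs_span_map (F := malg_map (plug (mone, m)))) spf => q s Gs _.
by exists (mone *w q.1, q.2 *w m), s; split; [| |apply: plugl_word_comp].
Qed.

Section Basis.
Context (I : ideal {malg k[{fmonom Z}]}).
Hypothesis genI : ideal_gen G = I.

(** Well-founded induction on words: a reducible word is congruent to a
    combination of smaller words, the tail of a relation placed in a context. *)
Lemma normal_form f : exists2 g,
  forall m, m \in msupp g -> ~ reducible plug le G m & ideal_set I (f - g).
Proof.
have [I0 IB IMl IMr] := idealP I.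
have IN x : ideal_set I x -> ideal_set I (- x) by rewrite -sub0r; apply: IB.
have ID x y : ideal_set I x -> ideal_set I y -> ideal_set I (x + y).
  by move=> Ix Iy; rewrite -[y]opprK; apply/IB/IN.
pose Q h := exists2 g,
  forall m, m \in msupp g -> ~ reducible plug le G m & ideal_set I (h - g).
have Q0 : Q 0 by exists 0; rewrite ?subr0 // => m; rewrite msupp0.
have QD a h1 h2 : Q h1 -> Q h2 -> Q (a *: h1 + h2).
  move=> [g1 irr1 I1] [g2 irr2 I2]; exists (a *: g1 + g2).
    move=> m /(fsubsetP (msuppD_le _ _)); rewrite inE => /orP[|/irr2//].
    by move=> /(fsubsetP (msuppZ_le _ _))/irr1.
  rewrite scalerP_sub; apply: ID => //.
  by rewrite -mul_malgC; apply: IMl.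
apply: (malg_ind Q0 QD) f; apply: (well_order_ind le_wo) => u IH.
have [[s [q [Gs sN0 eq_u]]]|irr_u] := pselect (reducible plug le G u);
  last first.
  by exists << u >>; rewrite ?subrr // => m; rewrite msuppU1 inE => /eqP->.
pose t := << lead s >> - monic s.
have [g irr_g Ig] : Q (plugl plug q t).
  rewrite /plugl [t]malg_sumE linear_sum big_seq.
  elim/big_rec: _ => // m h /(monicize_tail le_refl le_trans le_total sN0) lt_m.
  rewrite linearZ /= malg_mapU; apply: QD; apply: IH.
  by rewrite eq_u; apply: le_plug.
exists g => //; have -> : << u >> = plugl plug q (monic s) + plugl plug q t.
  by rewrite pluglB pluglU -eq_u addrC subrK.
rewrite -addrA; apply: ID => //; rewrite plugl_word; apply/IMr/IMl.
rewrite monicizeE -mul_malgC; apply: IMl; rewrite -genI => J [_]; exact.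
Qed.

(** Reduction shows that the irreducible words span; for freeness, a nonzero
    combination of irreducible words that lies in the ideal would have a
    reducible leading monomial. *)
Theorem composition_diamond :
  is_linear_basis (~` reducible plug le G) (fun u => quot_pi I << u >>).
Proof.
split=> [r a r_uniq irr_r|].
  pose f : {malg k[{fmonom Z}]} := \sum_(t <- r) a t *: << t >>.
  have coef_f u : f@_u = if u \in r then a u else 0 by apply: mcoeff_sum_uniq.
  under eq_bigr do rewrite quot_piZ.
  rewrite -raddf_sum => f0 t tr; have [f_eq0|fN0] := eqVneq f 0.
    by have := coef_f t; rewrite f_eq0 mcoeff0 tr.
  have If : ideal_set I f.
    by rewrite -[f]subr0; apply/quot_piP; rewrite raddf0.
  rewrite -genI in If; have := lead_span_reducible (ideal_gen_span If) fN0.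
  have := lead_supp le fN0; rewrite -mcoeff_neq0 coef_f.
  by case: ifP => [/irr_r//|_]; rewrite eqxx.
elim/quot_ind=> f; have [g irr_g If] := normal_form f.
exists (msupp g), (fun u => g@_u); split=> //.
have -> : quot_pi I f = quot_pi I g by apply/quot_piP.
rewrite {1}[g]malg_sumE raddf_sum; apply: eq_bigr => t _.
by rewrite quot_piZ.
Qed.

End Basis.
End Diamond.

(** * Star words and bracket-free words *)

Section StarWords.
Context (Z : choiceType).
Implicit Types (q : star_word Z) (u v w a b : bword Z) (m : {fmonom Z}).

(** The inclusion of bracketed words over [Z] into bracketed words over [Z]
    with the star; its image consists of the words without star. *)
Fixpoint unstarred (l : letter Z) : letter (option Z) :=
  match l with
  | Gen z => Gen (Some z)
  | Brk s => Brk (map unstarred s)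
  end.

Lemma unstarred_stars l : letter_stars (unstarred l) = 0%N.
Proof.
move: l; fix IH 1 => -[z|s] /=; first reflexivity.
by elim: s => [|l s IHs] /=; [reflexivity|rewrite IH IHs].
Qed.

Lemma unstarred_subst x l : letter_subst x (unstarred l) = [:: l].
Proof.
move: l; fix IH 1 => -[z|s] /=; first reflexivity.
by congr [:: Brk _]; elim: s => [|l s IHs] /=; [reflexivity|rewrite IHs IH].
Qed.

Lemma sumn_unstarred s : sumn (map (@letter_stars Z) (map unstarred s)) = 0%N.
Proof. by elim: s => //= l s ->; rewrite unstarred_stars. Qed.

Lemma flatten_unstarred x s :
  flatten (map (letter_subst x) (map unstarred s)) = s.
Proof. by elim: s => //= l s ->; rewrite unstarred_subst. Qed.

Lemma letter_stars0 (l : letter (option Z)) :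
  letter_stars l = 0%N -> exists l', l = unstarred l'.
Proof.
move: l; fix IH 1 => -[[z|]|s] /=; [by exists (Gen z)|discriminate|].
suff sP : sumn (map (@letter_stars Z) s) = 0%N ->
    exists s', s = map unstarred s'.
  by move=> /sP[s' ->]; exists (Brk s').
elim: s => [_|l s IHs /= /eqP]; first by exists [::].
rewrite addn_eq0 => /andP[/eqP/IH[l' ->] /eqP/IHs[s' ->]].
by exists (l' :: s').
Qed.

Lemma sumn_stars0 (s : seq (letter (option Z))) :
  sumn (map (@letter_stars Z) s) = 0%N -> exists s', s = map unstarred s'.
Proof.
by move=> s0; case: (@letter_stars0 (Brk s) s0) => -[//|s'] [->]; exists s'.
Qed.

Lemma sumn_stars1 (s : seq (letter (option Z))) :
  sumn (map (@letter_stars Z) s) = 1%N ->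
  exists s1 l s2, s = map unstarred s1 ++ l :: map unstarred s2 /\
    letter_stars l = 1%N.
Proof.
elim: s => //= l s IHs; case El: (letter_stars l) => [|[|//]].
  have [l' ->] := letter_stars0 El.
  by rewrite add0n => /IHs[s1 [l1 [s2 [-> l1P]]]]; exists (l' :: s1), l1, s2.
by move=> [/sumn_stars0[s2 ->]]; exists [::], l, s2.
Qed.

Definition mk_star (s : bword (option Z)) (s1 : stars s == 1%N) : star_word Z :=
  exist (fun s => stars s == 1%N) s s1.

Lemma star_ctx_subproof a b :
  stars (FMonom (map unstarred a ++ Gen None :: map unstarred b)) == 1%N.
Proof. by rewrite /stars /= map_cat sumn_cat /= !sumn_unstarred. Qed.

Definition star_ctx a b : star_word Z := mk_star (star_ctx_subproof a b).

Lemma star_ctxE a b u : star_subst (star_ctx a b) u = a *w u *w b.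
Proof.
apply/eqP; rewrite fmP !fmM /= map_cat flatten_cat /= !flatten_unstarred.
by rewrite catA.
Qed.

Lemma bracket_ctx_subproof q : stars (FMonom [:: Brk (val q)]) == 1%N.
Proof. by rewrite /stars /= addn0; exact: valP q. Qed.

Definition bracket_ctx q : star_word Z := mk_star (bracket_ctx_subproof q).

Lemma bracket_ctxE q u :
  star_subst (bracket_ctx q) u = bracket (star_subst q u).
Proof. by []. Qed.

(** The unique star of [q] stands either at top level or inside exactly one
    top-level bracket.  Only the substitution function attached to [q] matters
    below, hence the functional form of the statement. *)
Lemma star_word_cases q : exists a b,
  (forall u, star_subst q u = a *w u *w b) \/
  exists q', forall u, star_subst q u = a *w bracket (star_subst q' u) *w b.
Proof.
case: q => -[s] /= q1; have := eqP q1; rewrite /stars /= => /sumn_stars1.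
move=> [s1 [l [s2 [s_eq l1]]]].
have substE u : star_subst (mk_star (s := FMonom s) q1) u =
    FMonom s1 *w FMonom (letter_subst u l) *w FMonom s2.
  apply/eqP; rewrite fmP !fmM /= s_eq map_cat flatten_cat /=.
  by rewrite !flatten_unstarred catA.
exists (FMonom s1), (FMonom s2).
case: l l1 {s_eq} substE => [[//|]|s'] /= l1 substE.
  left=> u; rewrite substE; congr (_ *w _ *w _); exact: fmK.
by right; exists (mk_star (s := FMonom s') (introT eqP l1)).
Qed.

Lemma bracket_inj : injective (@bracket Z).
Proof. by move=> [u] [v] [->]. Qed.

(** The equation [u = [u]] would make a letter contain itself. *)
Lemma bracket_neq u : u <> bracket u.
Proof.
suff neq (l : letter Z) : l <> Brk [:: l].
  case: u => s /(congr1 (@fmonom_val _)) /=.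
  by case: s => [|l [|l' s]] // [/neq].
move: l; fix IH 1 => -[z|[|l [|l' s]]]; try discriminate.
by move=> [eq_l]; apply: (IH l).
Qed.

Lemma bracket_mul_eq u v a b :
  a *w bracket u *w b = bracket v -> [/\ a = mone, b = mone & u = v].
Proof.
move=> eq_v; have /eqP := congr1 (@fdeg _) eq_v.
have deg1 x : fdeg (bracket x) = 1%N by [].
rewrite !fdegM !deg1 addn1 addSn eqSS addn_eq0 !fdeg_eq0.
move=> /andP[/eqP a1 /eqP b1].
by split=> //; apply: bracket_inj; rewrite -eq_v a1 b1 mul1m mulm1.
Qed.

Lemma word_inclM : {morph (@word_incl Z) : m n / m *w n}.
Proof. by move=> m n; apply/eqP; rewrite fmP fmM /= fmM map_cat. Qed.

Lemma word_incl1 : word_incl (mone : {fmonom Z}) = mone.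
Proof. by apply/eqP; rewrite fmP fm1 /= fm1. Qed.

Lemma word_incl_inj : injective (@word_incl Z).
Proof.
move=> [m] [n] [eq_mn]; congr FMonom; apply: inj_map eq_mn.
by move=> x y [].
Qed.

Definition unbracket_word w : {fmonom Z} :=
  FMonom (pmap (fun l => if l is Gen z then Some z else None) (fmonom_val w)).

Lemma word_inclK : cancel (@word_incl Z) unbracket_word.
Proof. by case=> s; congr FMonom => /=; elim: s => //= z s ->. Qed.

Lemma fdeg_word_incl m : fdeg (word_incl m) = fdeg m.
Proof. exact: size_map. Qed.

Lemma word_incl_factor m u v : word_incl m = u *w v ->
  exists m1 m2, [/\ u = word_incl m1, v = word_incl m2 & m = m1 *w m2].
Proof.
move=> eq_m; have := congr1 (@fmonom_val _) eq_m; rewrite fmM /= => eq_s.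
have u_eq : u = word_incl (FMonom (take (size u) m)).
  by apply/eqP; rewrite fmP /= map_take eq_s take_size_cat.
have v_eq : v = word_incl (FMonom (drop (size u) m)).
  by apply/eqP; rewrite fmP /= map_drop eq_s drop_size_cat.
exists (FMonom (take (size u) m)), (FMonom (drop (size u) m)); split=> //.
by apply: word_incl_inj; rewrite word_inclM -u_eq -v_eq.
Qed.

Lemma word_incl_bracketF m a u b : word_incl m <> a *w bracket u *w b.
Proof.
move=> /word_incl_factor[m1 [_ [/esym/word_incl_factor[_ [m2 [_ + _]]] _ _]]].
by case: m2 => -[|z s].
Qed.

Lemma word_incl_or_bracket w :
  (exists m, w = word_incl m) \/ exists a u b, w = a *w bracket u *w b.
Proof.
case: w => s; elim: s => [|[z|t] s [[m [->]]|[a [u [b eq_s]]]]].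
- by left; exists (FMonom [::]).
- by left; exists (FMonom (z :: m)).
- right; exists (FMonom (Gen z :: a)), u, b; apply/eqP; rewrite fmP !fmM /=.
  by have := congr1 (@fmonom_val _) eq_s; rewrite !fmM /= => ->.
- right; exists mone, (FMonom t), (word_incl m).
  by apply/eqP; rewrite fmP !fmM fm1.
right; exists mone, (FMonom t), (FMonom s).
by apply/eqP; rewrite fmP !fmM fm1.
Qed.

End StarWords.

(** * Bracketed words under a monomial order *)

Lemma eq_plugl (k : fieldType) (X : choiceType) (C D : Type)
    (plug : C -> {fmonom X} -> {fmonom X})
    (plug' : D -> {fmonom X} -> {fmonom X}) q q' (f : {malg k[{fmonom X}]}) :
  (forall u, plug q u = plug' q' u) -> plugl plug q f = plugl plug' q' f.
Proof. by move=> /funext eq_q; rewrite /plugl eq_q. Qed.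

Lemma plugl_id (k : fieldType) (Z : choiceType) (f : {malg k[bword Z]}) :
  plugl (@star_subst Z) (star_ctx mone mone) f = f.
Proof.
rewrite {2}[f]malg_sumE; apply: eq_bigr => m _.
by rewrite star_ctxE mul1m mulm1.
Qed.

Section MonomialOrder.
Context (Z : choiceType) (le : rel (bword Z)).
Hypothesis le_mon : monomial_order le.
Implicit Types (u v w : bword Z) (q : star_word Z).

Let le_refl : reflexive le. Proof. by case: le_mon => -[]. Qed.
Let le_anti : antisymmetric le. Proof. by case: le_mon => -[]. Qed.
Let le_trans : transitive le. Proof. by case: le_mon => -[]. Qed.
Let le_total : total le. Proof. by case: le_mon => -[]. Qed.

Let strictNge u v : strict le u v -> le v u -> False.
Proof.
by move=> /andP[/eqP uv le_uv] le_vu; apply/uv/le_anti; rewrite le_uv.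
Qed.

Let not_strict u v : ~ strict le u v -> le v u.
Proof.
move=> uv; case/orP: (le_total v u) => // le_uv.
by have [->//|uNv] := eqVneq u v; case: uv; rewrite /strict uNv.
Qed.

(** If [m] is the least word and [m < 1], then multiplying on the left by
    [m] gives [m m < m]. *)
Lemma le_one u : le mone u.
Proof.
have [[_ _ _ _ le_min] le_subst] := le_mon.
have [m _ mP] := le_min setT (ex_intro _ u I).
apply: le_trans (mP u I); apply: not_strict => lt_m1.
have := le_subst (star_ctx m mone) _ _ lt_m1; rewrite !star_ctxE !mulm1.
by move/strictNge; apply; apply: mP.
Qed.

Lemma strict_bracket u v : strict le u v -> strict le (bracket u) (bracket v).
Proof.
move=> uv.
have := le_mon.2 (bracket_ctx (star_ctx (mone : bword Z) mone)) _ _ uv.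
by rewrite !bracket_ctxE !star_ctxE !mul1m !mulm1.
Qed.

(** Well-founded induction on [u]: from [[u] < u] the induction hypothesis for
    [[u]] gives [[u] <= [[u]]], while bracketing [[u] < u] gives
    [[[u]] < [u]]. *)
Lemma lt_bracket u : u <> bracket u -> strict le u (bracket u).
Proof.
have [le_wo _] := le_mon.
have le_brk : le u (bracket u).
  move: u; apply: (well_order_ind le_wo) => u IH.
  apply: not_strict => lt_u.
  exact: strictNge (strict_bracket lt_u) (IH _ lt_u).
by move=> uN; rewrite /strict le_brk andbT; apply/eqP.
Qed.

Context (le0 : rel {fmonom Z}).
Hypothesis le_le0 : forall m n, le (word_incl m) (word_incl n) = le0 m n.

Lemma strict_word_incl m n :
  strict le (word_incl m) (word_incl n) = strict le0 m n.
Proof. by rewrite /strict le_le0 (inj_eq (@word_incl_inj Z)). Qed.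

Lemma well_order_words : well_order le0.
Proof.
have [[_ _ _ _ le_min] _] := le_mon.
split=> [m|m n|n m p|m n|A [m0 Am0]]; rewrite -?le_le0 //.
- by move=> /le_anti/word_incl_inj.
- exact: le_trans.
have [_ [m Am <-] mP] := le_min (@word_incl Z @` A)
  (ex_intro _ _ (ex_intro2 _ _ m0 Am0 erefl)).
by exists m => // n An; rewrite -le_le0; apply: mP; exists n.
Qed.

Lemma strict_word_plug p m n :
  strict le0 m n -> strict le0 (word_plug p m) (word_plug p n).
Proof.
rewrite -!strict_word_incl => mn.
have := le_mon.2 (star_ctx (word_incl p.1) (word_incl p.2)) _ _ mn.
by rewrite !star_ctxE -!word_inclM.
Qed.

Section Leads.
Context (k : fieldType).
Implicit Types (f g : {malg k[{fmonom Z}]}).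

Lemma alg_incl0 : alg_incl (0 : {malg k[{fmonom Z}]}) = 0.
Proof. exact: linear0. Qed.

Lemma alg_inclB f g : alg_incl (f - g) = alg_incl f - alg_incl g.
Proof. exact: linearB. Qed.

Lemma alg_inclZ a f : alg_incl (a *: f) = a *: alg_incl f.
Proof. exact: linearZ. Qed.

Lemma alg_inclP a f g : alg_incl (a *: f + g) = a *: alg_incl f + alg_incl g.
Proof. exact: linearP. Qed.

Lemma alg_inclU m : alg_incl << m >> = << word_incl m >> :> {malg k[bword Z]}.
Proof. exact: malg_mapU. Qed.

Lemma alg_inclM f g : alg_incl (f * g) = alg_incl f * alg_incl g.
Proof.
apply: (linear_malg_mul (F := malg_map (@word_incl Z))) => u v /=.
rewrite (malg_mapU _ _ (u *w v)) (malg_mapU _ _ u) (malg_mapU _ _ v).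
by rewrite word_inclM malgMU.
Qed.

Lemma mcoeff_alg_incl f m : (alg_incl f)@_(word_incl m) = f@_m.
Proof. exact/mcoeff_malg_map/word_incl_inj. Qed.

Lemma alg_incl_inj : injective (@alg_incl k Z).
Proof.
move=> f g fg; apply/malgP => m.
by rewrite -!(mcoeff_alg_incl _ m) fg.
Qed.

Lemma alg_incl_plugl (a b : {fmonom Z}) f :
  alg_incl (plugl (@word_plug Z) (a, b) f) =
  plugl (@star_subst Z) (star_ctx (word_incl a) (word_incl b)) (alg_incl f).
Proof.
rewrite /alg_incl /plugl !malg_map_comp; congr (malg_map _ f).
by apply/funext => m /=; rewrite star_ctxE /word_plug !word_inclM.
Qed.

Lemma lead_alg_incl f : lead le (alg_incl f) = word_incl (lead le0 f).
Proof.
have [_ le0_anti le0_trans le0_total _] := well_order_words.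
have [le0_refl _ _ _ _] := well_order_words.
have [->|fN0] := eqVneq f 0.
  by rewrite alg_incl0 !lead0 word_incl1.
apply: (lead_unique le_refl le_anti le_trans le_total).
  by rewrite -mcoeff_neq0 mcoeff_alg_incl lead_coef_neq0.
move=> _ /msupp_malg_map[m fm ->]; rewrite le_le0.
exact: lead_max.
Qed.

Lemma monicize_alg_incl f :
  monicize le (alg_incl f) = alg_incl (monicize le0 f).
Proof.
by rewrite (monicizeE le) lead_alg_incl mcoeff_alg_incl -alg_inclZ.
Qed.

Lemma alg_incl_eq0 f : alg_incl f != 0 -> f != 0.
Proof. by apply: contraNneq => ->; rewrite alg_incl0. Qed.

End Leads.
End MonomialOrder.

(** * Compositions in the operated algebra *)

Lemma eq_transport2 (T : Type) (R : T -> T -> Prop) x x' y y' :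
  x = x' -> y = y' -> R x' y' -> R x y.
Proof. by move=> -> ->. Qed.

Section OperatedGS.
Context (k : fieldType) (Z : choiceType) (le : rel (bword Z)).
Context (le0 : rel {fmonom Z}) (c : k) (G : set {malg k[{fmonom Z}]}).
Hypothesis le_mon : monomial_order le.
Hypothesis le_le0 : forall m n, le (word_incl m) (word_incl n) = le0 m n.
Hypothesis lead_phi : forall u : bword Z, lead le (phi_at c u) = bracket u.
Hypothesis G_GS : GS_basis (@word_plug Z) le0 G.
Implicit Types (u v w : bword Z) (q : star_word Z).
Implicit Types (f g : {malg k[bword Z]}).

Local Notation SG := (S_phi c `|` (@alg_incl k Z @` G)).
Local Notation plug := (@star_subst Z).
Local Notation span w := (gs_span plug le SG (fun u => strict le u w)).

Let le_refl : reflexive le. Proof. by case: le_mon => -[]. Qed.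
Let le_anti : antisymmetric le. Proof. by case: le_mon => -[]. Qed.
Let le_trans : transitive le. Proof. by case: le_mon => -[]. Qed.
Let le_total : total le. Proof. by case: le_mon => -[]. Qed.

Lemma coef_phi u : (phi_at c u)@_(bracket u) = 1.
Proof.
rewrite mcoeffB mcoeffZ mcoeffUU mcoeffU.
by case: eqP => [/bracket_neq//|_]; rewrite mulr0 subr0.
Qed.

Lemma phi_neq0 u : phi_at c u != 0.
Proof.
apply/eqP => phi0; have := coef_phi u; rewrite phi0 mcoeff0 => /eqP.
by rewrite eq_sym oner_eq0.
Qed.

Lemma monicize_phi u : monicize le (phi_at c u) = phi_at c u.
Proof. by rewrite monicizeE lead_phi coef_phi invr1 scale1r. Qed.

Lemma SG_phi u : SG (phi_at c u). Proof. by left; exists u. Qed.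

Lemma SG_incl s : G s -> SG (alg_incl s). Proof. by right; exists s. Qed.

(** The word [w] of an intersection is longer than both leading monomials but
    shorter than their concatenation, which is impossible when one of them is
    a single letter. *)
Lemma intersections_trivial1 f g :
  fdeg (lead le f) = 1%N \/ fdeg (lead le g) = 1%N ->
  intersections_trivial plug le SG f g.
Proof.
move=> deg1 w u v _ _; rewrite gtn_max => /andP[].
by case: deg1 => ->; [rewrite add1n|rewrite addn1]; rewrite ltnS => lt1 lt2;
  rewrite leqNgt ?lt1 ?lt2.
Qed.

(** With [l] the leading monomial of [g], made monic, and [t = l - g], the
    composition [[u] - c u - [q'|_g]] equals
    [([q'|_t] - c q'|_t) - c q'|_g]; here the parenthesis is a combination of
    elements of [S_phi], one for each monomial of [t], the last
    term is below [[u]] because its leading monomial is [u]. *)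
Lemma bracket_inclusion g q q' u : SG g -> g != 0 ->
  (forall x, plug q x = bracket (plug q' x)) -> u = plug q' (lead le g) ->
  span (bracket u) (phi_at c u - plugl plug q (monicize le g)).
Proof.
move=> SGg gN0 qE uE; pose t := << lead le g >> - monicize le g.
have plug_t : plugl plug q t - c *: plugl plug q' t =
    \sum_(m <- msupp t) t@_m *: phi_at c (plug q' m).
  rewrite /plugl /malg_map scaler_sumr -sumrB; apply: eq_bigr => m _.
  by rewrite qE scalerA mulrC -scalerA -scalerBr.
have -> : phi_at c u - plugl plug q (monicize le g) =
    (plugl plug q t - c *: plugl plug q' t) -
      c *: plugl plug q' (monicize le g).
  rewrite /t !pluglB !pluglU qE -uE; exact: sub_phi.
rewrite plug_t; apply: gs_spanB; last first.
  apply: gs_spanZ; rewrite monicizeE pluglZ; apply: gs_spanU => //.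
  by rewrite -uE; apply: (lt_bracket le_mon); apply: bracket_neq.
apply: gs_span_sum => m /(monicize_tail le_refl le_trans le_total gN0) lt_m.
have -> : phi_at c (plug q' m) =
    plugl plug (star_ctx mone mone) (phi_at c (plug q' m)). by rewrite plugl_id.
apply: gs_spanU; first exact: SG_phi.
rewrite star_ctxE mul1m mulm1 lead_phi uE; apply: (strict_bracket le_mon).
exact: le_mon.2.
Qed.

(** The empty word is the least one, so a leading monomial [1] leaves no room
    for a tail. *)
Lemma monicize_const g :
  g != 0 -> lead le g = mone -> monicize le g = << mone >>.
Proof.
move=> gN0 lead1; apply/esym/eqP; rewrite -subr_eq0 -msupp_eq0.
apply/eqP/fsetP => m; rewrite in_fset0; apply/negP; rewrite -lead1.
move=> /(monicize_tail le_refl le_trans le_total gN0) /andP[/eqP neq le_m].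
by apply/neq/le_anti; rewrite le_m lead1 (le_one le_mon).
Qed.

(** Besides the case treated by [bracket_inclusion], the star of [q] may be at
    top level.  Then either [q] is the star itself and the composition
    vanishes, or the leading monomial of [g] is the empty word; in that case
    [g] is a constant and [- c u] is a multiple of [g] in a context. *)
Lemma inclusions_trivial_phi u g : SG g -> g != 0 ->
  inclusions_trivial plug le SG (phi_at c u) (monicize le g).
Proof.
move=> SGg gN0 _ q ->.
rewrite lead_phi (lead_monicize _ gN0) trivial_modE => u_eq.
have [a [b [qE|[q' qE]]]] := star_word_cases q; last first.
  move: u_eq; rewrite qE => /esym/bracket_mul_eq[a1 b1 u_eq].
  apply: (bracket_inclusion (q' := q')) => // x.
  by rewrite qE a1 b1 mul1m mulm1.
case: (SGg) gN0 u_eq => [[v _ <-] _|[s Gs <-] sN0] u_eq.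
  rewrite lead_phi qE in u_eq; have [a1 b1 <-] := bracket_mul_eq (esym u_eq).
  have -> : plugl plug q (monicize le (phi_at c v)) = phi_at c v.
    rewrite monicize_phi -[RHS]plugl_id; apply: eq_plugl => x.
    by rewrite qE a1 b1 star_ctxE.
  by rewrite subrr; exact: gs_span0.
have lead1 : lead le (alg_incl s) = mone.
  rewrite (lead_alg_incl le_mon le_le0) qE in u_eq *.
  (* A nonempty leading monomial would fill the single letter of [[u]]. *)
  have [->|l_neq1] := eqVneq (lead le0 s) mone; first exact: word_incl1.
  have := congr1 (@fdeg _) u_eq; rewrite !fdegM fdeg_word_incl.
  have : (0 < fdeg (lead le0 s))%N by rewrite lt0n fdeg_eq0.
  case: (fdeg _) => // n _ /eqP; rewrite addnS addSn eqSS eq_sym !addn_eq0.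
  rewrite !fdeg_eq0 -andbA => /and3P[/eqP a1 _ /eqP b1].
  case: (@word_incl_bracketF _ (lead le0 s) mone u mone).
  by rewrite u_eq a1 b1 !mul1m !mulm1.
have monic1 := monicize_const sN0 lead1.
have -> : plugl plug q (monicize le (alg_incl s)) = << bracket u >>.
  by rewrite monic1 pluglU u_eq lead1.
have -> : phi_at c u - << bracket u >> =
    (- c) *: plugl plug (star_ctx u mone) (monicize le (alg_incl s)).
  by rewrite monic1 pluglU star_ctxE !mulm1 scaleNr addrAC subrr sub0r.
rewrite monicizeE pluglZ scalerA; apply: gs_spanU; first exact: SG_incl.
rewrite lead1 star_ctxE !mulm1; apply: (lt_bracket le_mon).
exact: bracket_neq.
Qed.

Lemma trivial_alg_incl (w : {fmonom Z}) (h : {malg k[{fmonom Z}]}) :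
  trivial_mod (@word_plug Z) le0 G w h ->
  span (word_incl w) (alg_incl h).
Proof.
rewrite trivial_modE.
apply: (gs_span_map (F := malg_map (@word_incl Z))) => -[a b] s Gs lt_w.
exists (star_ctx (word_incl a) (word_incl b)), (alg_incl s); split.
- exact: SG_incl.
- rewrite star_ctxE (lead_alg_incl le_mon le_le0) -!word_inclM.
  by rewrite (strict_word_incl le_le0).
exact: alg_incl_plugl.
Qed.

Lemma inclusions_trivial_incl (f g : {malg k[{fmonom Z}]}) :
  inclusions_trivial (@word_plug Z) le0 G f g ->
  inclusions_trivial plug le SG (alg_incl f) (alg_incl g).
Proof.
have lead_incl h := lead_alg_incl le_mon le_le0 (k := k) h.
move=> incl w q w_eq l_eq.
have {}w_eq := etrans w_eq (lead_incl f).
have {}l_eq := etrans l_eq (congr1 (plug q) (lead_incl g)).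
rewrite trivial_modE {}w_eq in l_eq *.
have [a [b [qE|[q' qE]]]] := star_word_cases q; last first.
  by rewrite qE in l_eq; case: (word_incl_bracketF l_eq).
rewrite qE in l_eq; have [m [b' [/esym m_eq b_eq _]]] := word_incl_factor l_eq.
have [a' [_ [a_eq _ _]]] := word_incl_factor m_eq.
have -> : plugl plug q (alg_incl g) =
    alg_incl (plugl (@word_plug Z) (a', b') g).
  rewrite alg_incl_plugl; apply: eq_plugl => x.
  by rewrite qE star_ctxE a_eq b_eq.
rewrite -alg_inclB; apply: trivial_alg_incl; apply: incl => //.
by apply: word_incl_inj; rewrite l_eq a_eq b_eq -!word_inclM.
Qed.

Lemma inclusions_trivial_incl_phi (f : {malg k[{fmonom Z}]}) v :
  inclusions_trivial plug le SG (alg_incl f) (phi_at c v).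
Proof.
move=> _ q ->; rewrite lead_phi (lead_alg_incl le_mon le_le0).
by have [a [b [->|[q' ->]]]] := star_word_cases q => /word_incl_bracketF.
Qed.

(** The outer factors [u] and [v] of the intersection are themselves
    bracket-free: by Levi's lemma they are factors of the two leading
    monomials. *)
Lemma intersections_trivial_incl (f g : {malg k[{fmonom Z}]}) :
  intersections_trivial (@word_plug Z) le0 G f g ->
  intersections_trivial plug le SG (alg_incl f) (alg_incl g).
Proof.
have lead_incl h := lead_alg_incl le_mon le_le0 (k := k) h.
have deg_incl h := etrans (congr1 (@fdeg _) (lead_incl h)) (fdeg_word_incl _).
move=> inter w u v w_eqf w_eqg lt_max lt_sum.
have {}w_eqf := etrans w_eqf (congr1 (mmul^~ u) (lead_incl f)).
have {}w_eqg := etrans w_eqg (congr1 (mmul v) (lead_incl g)).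
have {}lt_max := eq_transport2 (R := fun m n => (maxn m n < fdeg w)%N)
  (esym (deg_incl f)) (esym (deg_incl g)) lt_max.
have {}lt_sum := eq_transport2 (R := fun m n => (fdeg w < m + n)%N)
  (esym (deg_incl f)) (esym (deg_incl g)) lt_sum.
have le_v : (fdeg v <= fdeg (word_incl (lead le0 f)))%N.
  by move: lt_sum; rewrite w_eqg fdegM !fdeg_word_incl ltn_add2r => /ltnW.
have [m l_eq r_eq] := fmonom_levi (etrans (esym w_eqg) w_eqf) le_v.
have [v' [_ [v_eq _ _]]] := word_incl_factor l_eq.
have [_ [u' [_ u_eq _]]] := word_incl_factor r_eq.
have w_eq : w = word_incl (lead le0 f *w u').
  by rewrite w_eqf u_eq word_inclM.
have -> : alg_incl f * << u >> - << v >> * alg_incl g =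
    alg_incl (f * << u' >> - << v' >> * g).
  apply: etrans (esym (alg_inclB _ _)); rewrite u_eq v_eq -2!alg_inclU.
  by apply: f_equal2; [|congr (- _)]; apply/esym/alg_inclM.
rewrite trivial_modE w_eq; apply: trivial_alg_incl; apply: inter.
- by [].
- by apply: word_incl_inj; rewrite -w_eq w_eqg v_eq word_inclM.
- by move: lt_max; rewrite w_eq fdeg_word_incl.
by move: lt_sum; rewrite w_eq fdeg_word_incl.
Qed.

Theorem operated_GS_basis : GS_basis plug le SG.
Proof.
move=> f g SGf fN0 SGg gN0.
pose toIncl := @eq_transport2 _ (inclusions_trivial plug le SG).
pose toInter := @eq_transport2 _ (intersections_trivial plug le SG).
have monicE s := monicize_alg_incl le_mon le_le0 (k := k) s.
case: (SGf) fN0 => [[u _ <-] _|[s Gs <-] /alg_incl_eq0 sN0].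
  split; last first.
    apply: (toIncl _ _ _ _ (monicize_phi u) erefl).
    exact: inclusions_trivial_phi.
  apply: intersections_trivial1; left.
  by rewrite monicize_phi lead_phi.
case: (SGg) gN0 => [[v _ <-] _|[t Gt <-] /alg_incl_eq0 tN0]; split.
- apply: intersections_trivial1; right.
  by rewrite monicize_phi lead_phi.
- apply: (toIncl _ _ _ _ (monicE s) (monicize_phi v)).
  exact: inclusions_trivial_incl_phi.
- apply: (toInter _ _ _ _ (monicE s) (monicE t)).
  exact: intersections_trivial_incl (G_GS Gs sN0 Gt tN0).1.
apply: (toIncl _ _ _ _ (monicE s) (monicE t)).
exact: inclusions_trivial_incl (G_GS Gs sN0 Gt tN0).2.
Qed.

Lemma reducible_incl m :
  reducible plug le (@alg_incl k Z @` G) (word_incl m) <->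
  reducible (@word_plug Z) le0 G m.
Proof.
split=> [[_ [q [[s Gs <-] /alg_incl_eq0 sN0]]]|[s [q [Gs sN0 m_eq]]]].
  rewrite (lead_alg_incl le_mon le_le0) => m_eq; exists s.
  have [a [b [qE|[q' qE]]]] := star_word_cases q; rewrite qE in m_eq;
    last first.
    by case: (word_incl_bracketF m_eq).
  have [n [b' [/esym n_eq _ ->]]] := word_incl_factor m_eq.
  have [a' [l [_ /word_incl_inj <- ->]]] := word_incl_factor n_eq.
  by exists (a', b').
exists (alg_incl s), (star_ctx (word_incl q.1) (word_incl q.2)); split.
- by exists s.
- by apply: contra_neq sN0 => s0; apply: alg_incl_inj; rewrite s0 alg_incl0.
by rewrite (lead_alg_incl le_mon le_le0) star_ctxE m_eq /word_plug !word_inclM.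
Qed.

Lemma reducible_SG : reducible plug le SG =
  reducible plug le (@alg_incl k Z @` G) `|`
    [set w | exists q u, w = plug q (bracket u)].
Proof.
apply/seteqP; split=> w.
  move=> [s [q [[[u _ <-]|Gs] sN0 ->]]]; last by left; exists s, q.
  by right; exists q, u; rewrite lead_phi.
move=> [[s [q [Gs sN0 ->]]]|[q [u ->]]].
  by exists s, q; split; [right| |].
exists (phi_at c u), q.
by split; [exact: SG_phi|exact: phi_neq0|rewrite lead_phi].
Qed.

Lemma bracketed_words :
  [set w | exists q u, w = plug q (bracket u)] = ~` range (@word_incl Z).
Proof.
apply/seteqP; split=> w.
  move=> [q [u ->]] [m _]; have [a [b [->|[q' ->]]]] := star_word_cases q;
    exact: word_incl_bracketF.
move=> Nw; have [[m w_eq]|[a [u [b ->]]]] := word_incl_or_bracket w.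
  by case: Nw; exists m.
by exists (star_ctx a b), u; rewrite star_ctxE.
Qed.

Lemma Irr_SG : Irr le SG =
  range (@word_incl Z) `\` reducible plug le (@alg_incl k Z @` G).
Proof. by rewrite /Irr reducible_SG bracketed_words setCU setCK setIC. Qed.

Lemma Irr_SG_image :
  Irr le SG = @word_incl Z @` (~` reducible (@word_plug Z) le0 G).
Proof.
rewrite Irr_SG; apply/seteqP; split=> [_ [[m _ <-] irr_m]|_ [m irr_m <-]].
  by exists m => // /reducible_incl.
by split=> [|/reducible_incl//]; exists m.
Qed.

End OperatedGS.

(** * The bracket-eliminating retraction *)

Section WordInd.
Context (Z : choiceType).

(** Induction along the generation of the operated monoid by [Z]; it hides the
    nesting of sequences in the type of letters. *)
Lemma bword_ind (Q : bword Z -> Prop) :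
  Q mone -> (forall u v, Q u -> Q v -> Q (u *w v)) ->
  (forall z, Q (bgen z)) -> (forall u, Q u -> Q (bracket u)) ->
  forall u, Q u.
Proof.
move=> Q1 QM Qgen Qbrk.
have Qseq s : foldr (fun l => and (Q (FMonom [:: l]))) True s -> Q (FMonom s).
  elim: s => [_|l s IHs [Ql /IHs Qs]].
    by have -> : FMonom [::] = mone :> bword Z by apply/eqP; rewrite fmP fm1.
  have -> : FMonom (l :: s) = FMonom [:: l] *w FMonom s :> bword Z.
    by apply/eqP; rewrite fmP fmM.
  exact: QM.
have Qletter l : Q (FMonom [:: l]).
  move: l; fix IH 1 => -[z|s]; first exact: Qgen.
  by apply: (Qbrk (FMonom s)); apply: Qseq; elim: s => [|l s IHs] //=; split.
by case=> s; apply: Qseq; elim: s => //= l s IHs; split.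
Qed.

End WordInd.

Section Retraction.
Context (k : fieldType) (Z : choiceType) (c : k).

Fixpoint letter_retr (l : letter Z) : {malg k[{fmonom Z}]} :=
  match l with
  | Gen z => << fmu z >>
  | Brk s => c *: foldr (fun l f => letter_retr l * f) 1 s
  end.

Definition word_retr (u : bword Z) : {malg k[{fmonom Z}]} :=
  foldr (fun l f => letter_retr l * f) 1 (fmonom_val u).

Lemma word_retr1 : word_retr mone = 1.
Proof. by rewrite /word_retr fm1. Qed.

Lemma word_retrM u v : word_retr (u *w v) = word_retr u * word_retr v.
Proof.
rewrite /word_retr fmM; elim: (fmonom_val u) => [|l s IHs] /=.
  by rewrite mul1r.
rewrite IHs; exact: mulrA.
Qed.

Lemma word_retr_bracket u : word_retr (bracket u) = c *: word_retr u.
Proof. exact: mulr1. Qed.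

Lemma word_retr_incl m : word_retr (word_incl m) = << m >>.
Proof.
case: m => s; rewrite /word_retr /=; elim: s => [|z s IHs] /=.
  by apply: f_equal2; apply/eqP; rewrite // fmP fm1.
rewrite IHs malgMU; congr << _ >>.
by apply/eqP; rewrite fmP fmM fmU.
Qed.

HB.instance Definition _ := isMultiplicative.Build (bword Z)
  {malg k[{fmonom Z}]} word_retr (word_retrM, word_retr1).

(** The algebra morphism to the free associative algebra that turns each
    bracket into multiplication by [c], i.e., the structure map of the
    phi-algebra whose operator is that multiplication. *)
Definition retr : {malg k[bword Z]} -> {malg k[{fmonom Z}]} :=
  mmap (@malgC {fmonom Z} k) word_retr.

Lemma retrZ a f : retr (a *: f) = a *: retr f.
Proof. by rewrite /retr mmapZ mul_malgC. Qed.

Lemma retr_is_linear : linear retr.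
Proof. by move=> a f g; rewrite -retrZ /retr raddfD. Qed.

HB.instance Definition _ := GRing.isLinear.Build k {malg k[bword Z]}
  {malg k[{fmonom Z}]} _ retr retr_is_linear.

Lemma retr0 : retr 0 = 0. Proof. exact: linear0. Qed.

Lemma retrB f g : retr (f - g) = retr f - retr g.
Proof. exact: linearB. Qed.

Lemma retrP a f g : retr (a *: f + g) = a *: retr f + retr g.
Proof. exact: linearP. Qed.

Lemma retrU u : retr << u >> = word_retr u.
Proof. by rewrite /retr mmapU mul1r. Qed.

Lemma retrM f g : retr (f * g) = retr f * retr g.
Proof.
apply: (linear_malg_mul (F := retr)) => u v /=.
rewrite (retrU (u *w v)) (retrU u) (retrU v); exact: word_retrM.
Qed.

Lemma retr_oper f : retr (oper f) = c *: retr f.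
Proof.
apply: (linear_malg_ext (F1 := retr \o malg_map (@bracket Z))
  (F2 := c \*: retr)) => u /=.
by rewrite malg_mapU !retrU; apply: word_retr_bracket.
Qed.

Lemma alg_inclK : cancel (@alg_incl k Z) retr.
Proof.
apply: (linear_malg_ext (F1 := retr \o malg_map (@word_incl Z)) (F2 := idfun)).
by move=> m /=; rewrite malg_mapU retrU; apply: word_retr_incl.
Qed.

Lemma retr_phi u : retr (phi_at c u) = 0.
Proof. by rewrite linearB linearZ /= !retrU word_retr_bracket subrr. Qed.

End Retraction.

(** * The quotient by the operated ideal *)

Section ULinear.
Context (k : fieldType).
Implicit Types (U V W : uAlgType k).

Lemma uscale1 V (x : V) : 1 *:u x = x.
Proof. by rewrite /uscale (uscalar_is_monoid_morphism (s := V)).1 mul1r. Qed.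

Lemma ulinear0 V W (f : V -> W) : ulinear f -> f 0 = 0.
Proof.
move=> fL; have := fL 1 0 0; rewrite !uscale1 addr0 => /eqP.
by rewrite -subr_eq subrr => /eqP.
Qed.

Lemma ulinearZ V W (f : V -> W) a x : ulinear f -> f (a *:u x) = a *:u f x.
Proof. by move=> fL; have := fL a x 0; rewrite (ulinear0 fL) !addr0. Qed.

Lemma alg_morphism_comp U V W (f : V -> W) (g : U -> V) :
  alg_morphism f -> alg_morphism g -> alg_morphism (f \o g).
Proof.
move=> [fL [f1 fM]] [gL [g1 gM]]; split=> [a x y|]; first by rewrite /= gL fL.
by split=> [|x y] /=; rewrite ?g1 ?f1 ?gM ?fM.
Qed.

Lemma ulinear_sum V W (f : V -> W) (T : Type) (r : seq T) (a : T -> k)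
    (b : T -> V) : ulinear f ->
  f (\sum_(t <- r) a t *:u b t) = \sum_(t <- r) a t *:u f (b t).
Proof.
move=> fL; elim: r => [|t r IHr]; first by rewrite !big_nil ulinear0.
by rewrite !big_cons fL IHr.
Qed.

(** Bases are carried along linear isomorphisms.  The index set changes along an
    injection [h] with left inverse [h'], which serves to pull coefficient
    functions back. *)
Lemma linear_basis_transport V W (i : V -> W) (T U : choiceType)
    (h : T -> U) (h' : U -> T) (J : set T) (b : T -> V) (b' : U -> W) :
  ulinear i -> injective i -> (forall y, exists x, y = i x) ->
  cancel h h' -> (forall t, b' (h t) = i (b t)) ->
  is_linear_basis J b -> is_linear_basis (h @` J) b'.
Proof.
move=> iL i_inj i_surj hK b'E [b_free b_span].
have sumE r (a : U -> k) : \sum_(u <- map h r) a u *:u b' u =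
    i (\sum_(t <- r) a (h t) *:u b t).
  by rewrite big_map (ulinear_sum _ _ _ iL); under eq_bigr do rewrite b'E.
split=> [s a s_uniq sJ|y].
  have s_eq : s = map h (map h' s).
    rewrite -map_comp map_id_in // => u /sJ[t _ <-] /=.
    by rewrite hK.
  rewrite s_eq sumE -(ulinear0 iL) => /i_inj /b_free b0 u /mapP[t ts ->].
  apply: b0 ts => [|t']; first by move: s_uniq; rewrite {1}s_eq => /map_uniq.
  by move=> /mapP[u' /sJ[t'' Jt <-] ->]; rewrite hK.
have [x ->] := i_surj y; have [s [a [sJ ->]]] := b_span x.
exists (map h s), (a \o h'); split=> [_ /mapP[t /sJ Jt ->]|]; first by exists t.
by rewrite sumE; under [in RHS]eq_bigr do rewrite /= hK.
Qed.

End ULinear.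

Lemma opideal_genS (k : fieldType) (A : uOpAlgType k) (S : set A) x :
  S x -> opideal_gen_set S x.
Proof. by move=> Sx I [_]; apply. Qed.

Lemma opideal_gen_min (k : fieldType) (A : uOpAlgType k) (S I : set A) :
  is_opideal I -> S `<=` I -> opideal_gen_set S `<=` I.
Proof. by move=> I_id SI x; apply. Qed.

Section Quotient.
Context (k : fieldType) (Z : choiceType) (c : k).
Context (IA : ideal {malg k[{fmonom Z}]}).

Local Notation gens := (S_phi c `|` (@alg_incl k Z @` IA)).
Local Notation J := (opideal_gen gens).
Local Notation retr := (@retr k Z c).

(** The preimage of [IA] under [retr] is an operated ideal since bracketing
    becomes multiplication by [c], and it contains the generators. *)
Lemma retr_opideal f : opideal_gen_set gens f -> ideal_set IA (retr f).
Proof.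
have [I0 IB IMl IMr] := idealP IA.
apply: (opideal_gen_min (I := [set f | ideal_set IA (retr f)])); last first.
  move=> _ [[u _ <-]|[g Ig <-]] /=; first by rewrite retr_phi.
  by rewrite alg_inclK.
split=> [|f1 /= If]; last first.
  rewrite /mkset retr_oper -mul_malgC; exact: (IMl _ _ If).
split=> [|f1 f2 If1 If2|a f1 If|a f1 If]; rewrite /mkset.
- by rewrite retr0.
- rewrite retrB; exact: (IB _ _ If1 If2).
- rewrite retrM; exact: (IMl _ _ If).
- rewrite retrM; exact: (IMr _ _ If).
Qed.

(** Modulo [J], brackets can be eliminated one by one: the property is
    multiplicative in the word, and
    [[u] - retr [u] = ([u] - c u) + c (u - retr u)]. *)
Lemma sub_retr_opideal f : opideal_gen_set gens (f - alg_incl (retr f)).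
Proof.
have [J0 JB JMl JMr] := opideal_gen_is_ideal gens.
have JD x y : opideal_gen_set gens x -> opideal_gen_set gens y ->
    opideal_gen_set gens (x + y).
  move=> Jx Jy; have := JB _ _ Jx (JB _ _ J0 Jy).
  by rewrite sub0r opprK.
have JZ a x : opideal_gen_set gens x -> opideal_gen_set gens (a *: x).
  by move=> Jx; rewrite -mul_malgC; exact: (JMl _ _ Jx).
move: f; apply: malg_ind => [|a g h Jg Jh|u].
- by rewrite retr0 alg_incl0 subrr.
- rewrite retrP alg_inclP scalerP_sub; exact: (JD _ _ (JZ _ _ Jg) Jh).
move: u; apply: bword_ind => [|u v|z|u Ju].
- by rewrite retrU word_retr1 (alg_inclU k mone) word_incl1 subrr.
- move=> Ju Jv; rewrite -malgMU retrM alg_inclM.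
  rewrite mulr_sub2; exact: (JD _ _ (JMr _ _ Ju) (JMl _ _ Jv)).
- rewrite retrU /word_retr /= mulr1 alg_inclU.
  rewrite (_ : word_incl _ = bgen z) ?subrr //.
  by apply/eqP; rewrite fmP /= fmU.
have -> : << bracket u >> - alg_incl (retr << bracket u >>) =
    phi_at c u + c *: (<< u >> - alg_incl (retr << u >>)).
  rewrite !retrU word_retr_bracket alg_inclZ scalerBr addrA subrK.
  by [].
by apply: (JD _ _ _ (JZ _ _ Ju)); apply: opideal_genS; left; exists u.
Qed.

(** The bracket-free elements of an operated ideal form an ideal of the free
    associative algebra; it contains [IA] as soon as it contains [G]. *)
Lemma opideal_gen_alg_incl G : ideal_gen G = IA ->
  opideal_gen_set (S_phi c `|` (@alg_incl k Z @` G)) = opideal_gen_set gens.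
Proof.
move=> genI; apply/seteqP; split; apply: opideal_gen_min.
- exact: (conj (opideal_gen_is_ideal _) (@opideal_gen_oper _ _ _)).
- move=> _ [[u _ <-]|[s Gs <-]]; apply: opideal_genS; first by left; exists u.
  by right; exists s => //; rewrite -genI => I [_]; apply.
- exact: (conj (opideal_gen_is_ideal _) (@opideal_gen_oper _ _ _)).
set H := opideal_gen_set _.
have [H0 HB HMl HMr] : is_ideal H := opideal_gen_is_ideal _.
move=> _ [[u _ <-]|[f If <-]]; first by apply: opideal_genS; left; exists u.
rewrite -genI in If; have /(_ [set g | H (alg_incl g)]) := If.
apply; split.
  split=> [|g1 g2 H1 H2|a g Hg|a g Hg]; rewrite /mkset.
  - rewrite alg_incl0; exact: H0.
  - rewrite alg_inclB; exact: (HB _ _ H1 H2).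
  - rewrite alg_inclM; exact: (HMl _ _ Hg).
  - rewrite alg_inclM; exact: (HMr _ _ Hg).
by move=> s Gs; apply: opideal_genS; right; exists s.
Qed.

Definition quot_incl (x : quot IA) : opquot J :=
  opquot_pi J (alg_incl (quot_repr x)).

Definition quot_retr (y : opquot J) : quot IA :=
  quot_pi IA (retr (quot_repr (y : quot J))).

Lemma quot_incl_pi f : quot_incl (quot_pi IA f) = opquot_pi J (alg_incl f).
Proof.
apply/(quot_piP J); rewrite -alg_inclB; apply: opideal_genS; right.
by exists (quot_repr (quot_pi IA f) - f) => //; apply: quot_repr_pi.
Qed.

Lemma quot_retr_pi f : quot_retr (opquot_pi J f) = quot_pi IA (retr f).
Proof.
apply/quot_piP; rewrite -retrB; apply: retr_opideal.
exact: (@quot_repr_pi _ J f).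
Qed.

Lemma quot_inclK : cancel quot_incl quot_retr.
Proof.
by elim/quot_ind=> f; rewrite quot_incl_pi quot_retr_pi alg_inclK.
Qed.

Lemma quot_retrK : cancel quot_retr quot_incl.
Proof.
elim/(@quot_ind _ J) => f; rewrite -/(opquot_pi J f) quot_retr_pi quot_incl_pi.
apply/esym/(quot_piP J); exact: sub_retr_opideal.
Qed.

Lemma opquot_piP a f g :
  a *:u opquot_pi J f + opquot_pi J g = opquot_pi J (a *: f + g).
Proof.
rewrite -malg_uscaleE; exact/esym/((quot_pi_is_alg_morphism J).1 a f g).
Qed.

Lemma opquot_piZ a f : a *:u opquot_pi J f = opquot_pi J (a *: f).
Proof. exact: (quot_piZ J a f). Qed.

Lemma opquot_piM f g :
  opquot_pi J f * opquot_pi J g = opquot_pi J (f * g).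
Proof. exact/esym/((quot_pi_is_alg_morphism J).2.2 f g). Qed.

Lemma quot_incl_morphism : alg_morphism quot_incl.
Proof.
split=> [a|].
  elim/quot_ind=> f; elim/quot_ind=> g.
  rewrite quot_piZ -raddfD !quot_incl_pi opquot_piP; congr (opquot_pi J _).
  exact: alg_inclP.
split; last first.
  elim/quot_ind=> f; elim/quot_ind=> g.
  rewrite -rmorphM !quot_incl_pi opquot_piM; congr (opquot_pi J _).
  exact: alg_inclM.
have -> : 1 = quot_pi IA 1 by exact: erefl.
by rewrite quot_incl_pi (alg_inclU k mone) word_incl1.
Qed.

Lemma quot_retr_morphism : alg_morphism quot_retr.
Proof.
have [inclL [incl1 inclM]] := quot_incl_morphism.
have incl_inj := can_inj quot_inclK.
split=> [a x y|].
  apply: incl_inj; apply: etrans (quot_retrK _) (etrans _ (esym (inclL _ _ _))).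
  exact: (congr2 (fun x y => a *:u x + y) (esym (quot_retrK x))
    (esym (quot_retrK y))).
split=> [|x y]; apply: incl_inj; apply: etrans (quot_retrK _) _.
  exact: esym incl1.
apply: etrans _ (esym (inclM _ _)).
exact: (congr2 *%R (esym (quot_retrK x)) (esym (quot_retrK y))).
Qed.

Lemma oper_sub_opideal (f : {malg k[bword Z]}) :
  opideal_gen_set gens (oper f - c *: f).
Proof.
have [J0 JB JMl _] := opideal_gen_is_ideal gens.
move: f; apply: malg_ind => [|a g h Jg Jh|u].
- have -> : oper (0 : {malg k[bword Z]}) = 0 by apply: linear0.
  by rewrite scaler0 subr0; exact: J0.
- have -> : oper (a *: g + h) = a *: oper g + oper h by apply: linearP.
  have -> : c *: (a *: g + h) = a *: (c *: g) + c *: h.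
    by rewrite scalerDr !scalerA mulrC.
  rewrite scalerP_sub -mul_malgC.
  have := JB _ _ (JMl (- a%:MP) _ Jg) Jh.
  move/(JB _ _ J0); rewrite sub0r opprB addrC mulNr opprK.
  exact.
have -> : oper << u >> = << bracket u >> :> {malg k[bword Z]}.
  exact: malg_mapU.
by apply: opideal_genS; left; exists u.
Qed.

Lemma opquot_phi_algebra : is_phi_algebra c (opquot J).
Proof.
elim/(@quot_ind _ J) => f; apply/eqP; rewrite subr_eq0; apply/eqP.
rewrite -/(opquot_pi J f) opquot_piZ.
have -> : oper (opquot_pi J f) = opquot_pi J (oper f) := opquot_oper_pi J f.
by apply/(quot_piP J); exact: oper_sub_opideal.
Qed.

Lemma phi_algebra_oper (B : uOpAlgType k) (x : B) :
  is_phi_algebra c B -> oper x = c *:u x.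
Proof. by move=> /(_ x)/eqP; rewrite subr_eq0 => /eqP. Qed.

(** An algebra morphism between phi-algebras is compatible with the operators,
    which are multiplications by [c]; so a morphism from [A] extends uniquely
    through the isomorphism [quot_incl]. *)
Theorem quot_incl_free : is_free_phi_algebra c quot_incl.
Proof.
split; [exact: opquot_phi_algebra|exact: quot_incl_morphism|].
move=> B f B_phi f_mor.
have fr_mor := alg_morphism_comp f_mor quot_retr_morphism.
exists (f \o quot_retr); split; last first.
  by move=> g [_ gE]; apply/funext => y; rewrite -[y in RHS]quot_retrK gE.
split; last by move=> x; rewrite /= quot_inclK.
split=> // y.
rewrite (phi_algebra_oper y opquot_phi_algebra) (phi_algebra_oper _ B_phi).
exact: ulinearZ fr_mor.1.
Qed.

End Quotient.

Unset Implicit Arguments.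

Theorem proposition6p11 (k : fieldType) (Z : choiceType)
    (leZ : rel Z) (le : rel (bword Z)) (c : k)
    (IA : ideal {malg k[{fmonom Z}]}) (G : set {malg k[{fmonom Z}]}) :
  well_order leZ ->
  monomial_order le ->
  (forall u v : {fmonom Z}, le (word_incl u) (word_incl v) = dlex leZ u v) ->
  (forall u : bword Z, lead le (phi_at c u) = bracket u) ->
  GS_basis_of (dlex leZ) G IA ->
  let SG : set {malg k[bword Z]} := S_phi c `|` (@alg_incl k Z @` G) in
  let J := opideal_gen (S_phi c `|` (@alg_incl k Z @` IA)) in
  [/\ operated_GS_basis_of le SG J,
      Irr le SG =
        ~` (reducible (@star_subst Z) le (@alg_incl k Z @` G) `|`
            [set w | exists q u, w = star_subst q (bracket u)]),
      Irr le SG =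
        range (@word_incl Z) `\`
        reducible (@star_subst Z) le (@alg_incl k Z @` G),
      exists i : quot IA -> opquot J,
        (forall f, i (quot_pi IA f) = opquot_pi J (alg_incl f)) /\
        is_free_phi_algebra c i
    & is_linear_basis (Irr le SG)
        (fun u : bword Z => opquot_pi J << u >>)].
Proof.
move=> _ le_mon le_dlex lead_phi [G_GS genI] SG J.
split.
- split; first exact: operated_GS_basis le_mon le_dlex lead_phi G_GS.
  exact: opideal_gen_alg_incl.
- by rewrite /Irr (reducible_SG _ lead_phi).
- exact: Irr_SG.
- exists (@quot_incl k Z c IA); split; first exact: quot_incl_pi.
  exact: quot_incl_free.
rewrite (Irr_SG_image _ le_mon le_dlex lead_phi).
have basis_A := composition_diamond (well_order_words le_mon le_dlex)
  (strict_word_plug le_mon le_dlex) G_GS genI.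
have [inclL _] := quot_incl_morphism c IA.
apply: (linear_basis_transport inclL (can_inj (@quot_inclK k Z c IA)) _
  (@word_inclK Z) _ basis_A) => [y|m].
  by exists (quot_retr y); rewrite quot_retrK.
by rewrite quot_incl_pi alg_inclU.
Qed.
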